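(* Let $(a_n)_{n\in\mathbb N}$ be a strictly positive real sequence with $a_n\to0$ and $\sqrt n\,a_n\to\infty$. Let $\rho_{AB}\in\mathcal S(AB)$ with $V(A:B)_\rho>0$, and put $R_n:=I(A:B)_\rho-a_n$. Then $$\lim_{n\to\infty}-\frac{1}{na_n^2}\log\hat\alpha_{n,\rho}(e^{-nR_n})=\frac{1}{2V(A:B)_\rho},$$ and the same holds with $\hat\alpha_{n,\rho}$ replaced by $\hat\alpha^{\mathrm{iid}}_{n,\rho}$.
   Context: All Hilbert spaces are finite-dimensional, $\log$ is natural, $\mathcal S(A)$ is the set of density operators on $A$. $I(A:B)_\rho=H(A)_\rho+H(B)_\rho-H(AB)_\rho$ (von Neumann entropies). $V(A:B)_\rho=\operatorname{tr}[\rho_{AB}(\log\rho_{AB}-\log(\rho_A\otimes\rho_B)-I(A:B)_\rho)^2]$. $\mathcal S_{\mathrm{sym}}(A^{\otimes n})$: states invariant under all permutations of tensor factors. $\hat\alpha_{n,\rho}(\mu)=\min\{\operatorname{tr}[\rho_{AB}^{\otimes n}(1-T)]:0\le T\le1,\ \max_{\sigma_{A^n}\in\mathcal S_{\mathrm{sym}}(A^{\otimes n}),\tau_{B^n}\in\mathcal S_{\mathrm{sym}}(B^{\otimes n})}\operatorname{tr}[(\sigma_{A^n}\otimes\tau_{B^n})T]\le\mu\}$; $\hat\alpha^{\mathrm{iid}}_{n,\rho}(\mu)=\min\{\operatorname{tr}[\rho_{AB}^{\otimes n}(1-T)]:0\le T\le1,\ \max_{\sigma_A\in\mathcal S(A),\tau_B\in\mathcal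 S(B)}\operatorname{tr}[(\sigma_A^{\otimes n}\otimes\tau_B^{\otimes n})T]\le\mu\}$. *)

(* Defs.v *)
From mathcomp Require Import all_boot all_order all_algebra.
From mathcomp Require Import perm complex.
From mathcomp Require Import all_classical all_reals all_analysis.

Set Implicit Arguments.
Unset Strict Implicit.
Unset Printing Implicit Defensive.

Import Order.TTheory GRing.Theory Num.Theory.
Import numFieldNormedType.Exports.
Local Open Scope classical_set_scope.
Local Open Scope ring_scope.

Section QuantumDefs.
Variable R : realType.
Local Notation C := R[i].

Definition re (z : C) : R := complex.Re z.

Definition adj m n (M : 'M[C]_(m, n)) : 'M[C]_(n, m) := (map_mx Num.conj M)^T.

(** Operators on the Hilbert space C^T, T a finite type (the basis labels),
    are represented as #|T| x #|T| matrices; we access entries by labels. *)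
Definition op (T : finType) := 'M[C]_#|T|.
Definition entry (T : finType) (M : op T) (x y : T) : C :=
  M (enum_rank x) (enum_rank y).
Definition mkop (T : finType) (f : T -> T -> C) : op T :=
  \matrix_(i, j) f (enum_val i) (enum_val j).

(** Positive semidefinite: <v, M v> >= 0 for all v (this forces hermiticity
    over C). *)
Definition psd n (M : 'M[C]_n) : Prop :=
  forall v : 'rV[C]_n, 0 <= (v *m M *m adj v) 0 0.

Definition density (T : finType) (M : op T) : Prop := psd M /\ \tr M = 1.

Definition test (T : finType) (M : op T) : Prop := psd M /\ psd (1%:M - M).

(** Functional calculus for a normal (here: hermitian) matrix through the
    spectral decomposition M = P^-1 diag(d) P of mathcomp's spectral.v;
    f is applied to the (real) eigenvalues. *)
Definition mxfun n (f : R -> R) (M : 'M[C]_n) : 'M[C]_n :=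
  let P := spectralmx M in
  invmx P *m diag_mx (map_mx (fun z => Complex (f (re z)) 0) (spectral_diag M)) *m P.

(** Matrix logarithm, with the standard convention log 0 := 0 on the kernel
    (i.e. the log is taken on the support). *)
Definition logr (x : R) : R := if 0 < x then ln x else 0.
Definition mxlog n (M : 'M[C]_n) : 'M[C]_n := mxfun logr M.

Definition vN_entropy n (M : 'M[C]_n) : R := - re (\tr (M *m mxlog M)).

Definition ptrB (TA TB : finType) (M : op (TA * TB)%type) : op TA :=
  mkop (fun a a' => \sum_(b : TB) entry M (a, b) (a', b)).
Definition ptrA (TA TB : finType) (M : op (TA * TB)%type) : op TB :=
  mkop (fun b b' => \sum_(a : TA) entry M (a, b) (a, b')).
Definition tens (TA TB : finType) (X : op TA) (Y : op TB) : op (TA * TB)%type :=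
  mkop (fun (x y : (TA * TB)%type) => entry X x.1 y.1 * entry Y x.2 y.2).

Definition mutinf (TA TB : finType) (rho : op (TA * TB)%type) : R :=
  vN_entropy (ptrB rho) + vN_entropy (ptrA rho) - vN_entropy rho.

Definition mutinf_var (TA TB : finType) (rho : op (TA * TB)%type) : R :=
  let X := mxlog rho - mxlog (tens (ptrB rho) (ptrA rho))
           - (Complex (mutinf rho) 0)%:M in
  re (\tr (rho *m (X *m X))).

Definition tpow (T : finType) (n : nat) (M : op T) : op {ffun 'I_n -> T} :=
  mkop (fun (x y : {ffun 'I_n -> T}) => \prod_(k < n) entry M (x k) (y k)).

Definition perm_inv (T : finType) (n : nat) (M : op {ffun 'I_n -> T}) : Prop :=
  forall (s : {perm 'I_n}) (x y : {ffun 'I_n -> T}),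
    entry M [ffun k => x (s k)] [ffun k => y (s k)] = entry M x y.

Definition sym_density (T : finType) (n : nat) (M : op {ffun 'I_n -> T}) : Prop :=
  density M /\ perm_inv M.

(** sigma_{A^n} (x) tau_{B^n} as an operator on (AB)^{(x)n}, i.e. on the
    labels {ffun 'I_n -> TA * TB} (canonical reordering A^n B^n ~ (AB)^n). *)
Definition tens_n (TA TB : finType) (n : nat)
    (S : op {ffun 'I_n -> TA}) (U : op {ffun 'I_n -> TB})
    : op {ffun 'I_n -> (TA * TB)%type} :=
  mkop (fun (x y : {ffun 'I_n -> (TA * TB)%type}) => entry S [ffun k => (x k).1] [ffun k => (y k).1]
                 * entry U [ffun k => (x k).2] [ffun k => (y k).2]).

(** hat alpha_{n,rho}(mu): the minimum (= infimum, attained) of the type-I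
    error over tests whose type-II error against all products of
    permutation-invariant states is at most mu. *)
Definition alpha_hat (TA TB : finType) (rho : op (TA * TB)%type) (n : nat) (mu : R)
    : R :=
  inf [set x : R | exists Tn : op {ffun 'I_n -> (TA * TB)%type},
        [/\ test Tn,
            (forall (S : op {ffun 'I_n -> TA}) (U : op {ffun 'I_n -> TB}),
               sym_density S -> sym_density U ->
               re (\tr (tens_n S U *m Tn)) <= mu)
          & x = re (\tr (tpow n rho *m (1%:M - Tn)))]].

Definition alpha_hat_iid (TA TB : finType) (rho : op (TA * TB)%type) (n : nat) (mu : R)
    : R :=
  inf [set x : R | exists Tn : op {ffun 'I_n -> (TA * TB)%type},
        [/\ test Tn,
            (forall (S : op TA) (U : op TB),
               density S -> density U ->
               re (\tr (tens_n (tpow n S) (tpow n U) *m Tn)) <= mu)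
          & x = re (\tr (tpow n rho *m (1%:M - Tn)))]].

End QuantumDefs.

(* Main.v *)
Require Import Defs.
From mathcomp Require Import all_boot all_order all_algebra.
From mathcomp Require Import perm complex ring lra.
From mathcomp Require Import all_classical all_reals all_analysis.
Set Implicit Arguments.
Unset Strict Implicit.
Unset Printing Implicit Defensive.
Import Order.TTheory GRing.Theory Num.Theory.
Import numFieldNormedType.Exports.
Local Open Scope classical_set_scope.
Local Open Scope ring_scope.

(** Write rho = U* diag(r) U and, for the eigenvalues s of the
    product of the marginals, rhoA (x) rhoB = W* diag(s) W.  The weights
    p(x, y) = r_x |(U W* )_{xy}|^2 form a probability distribution under which
    Z = ln r_x - ln s_y has mean I(A:B) and variance V(A:B) (Nussbaum-Szkola),
    and p, Z factorise over tensor powers.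

    Converse: test against rhoA^n (x) rhoB^n only.  For every test, type-I error
    plus lam times type-II error is at least half of sum |U W*|^2 min(r, lam s),
    hence at least half of the probability of {sum_k Z_k <= ln lam}; the
    exponential tilting of this event gives the exponent 1/(2V).

    Achievability: the projector T onto the span of the vectors 1_{lam s < r_x} e_x
    has type-I error at most P(sum_k Z_k <= ln lam) and type-II error at most
    1/lam against rhoA^n (x) rhoB^n.  To handle all symmetric states, note that
    they are dominated by an operator Omega of polynomial trace commuting with
    all permutation-invariant operators; with P_A the projector onto
    {Omega <= e^(n d) rhoA^n}, the test (P_A (x) P_B) T (P_A (x) P_B) pays a factor
    e^(2 n d) in type-II error, and poly(n) e^(-n d) in type-I error.  For
    d = delta a_n both are negligible on the scale exp(- n a_n^2). *)

(** * Positive semidefinite matrices and functional calculus *)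

Section LinAlg.
Variable R : realType.
Local Notation C := R[i].
Local Notation "x %:c" := (Complex x (0:R)) (at level 2, format "x %:c").

(** Two bounds give all four one-sided estimates. The powers of the marginals are themselves an
    i.i.d. alternative, so the converse already holds for [alpha_hat_iid]; powers of states are
    symmetric, so [alpha_hat_iid] is at most [alpha_hat], and achievability is proved for
    [alpha_hat] alone. All losses are paid by moving the threshold: lam = e^(n (I - b)) with b = (1
    + delta) a_n in the converse and b = (1 - 2 delta) a_n in the achievability. This leaves a
    margin e^(- delta n a_n). As a_n -> 0, delta n a_n is large against n a_n^2; as sqrt n a_n ->
    oo, it is large against sqrt n, hence against the logarithm of any polynomial in n. The factors
    (1 + delta)^2 and (1 - 2 delta)^2 that appear in the exponent tend to 1 with delta. The state
    and the product of its marginals need not commute, so there is no joint eigenbasis in which to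
    take a likelihood ratio. This is why the distribution lives on pairs (x, y), one index for each
    eigenbasis, and why T comes from an orthonormalisation and not from a spectral projector. *)

Definition nsq (z : C) : R := complex.Re z ^+ 2 + complex.Im z ^+ 2.

Lemma nsq_ge0 z : 0 <= nsq z.
Proof. by rewrite addr_ge0 ?sqr_ge0. Qed.

Lemma nsqM z w : nsq (z * w) = nsq z * nsq w.
Proof. by case: z w => [a b] [c d]; rewrite /nsq /=; ring. Qed.

Lemma nsqE z : (nsq z)%:c = z * Num.conj z.
Proof. by case: z => [a b]; apply/eqP; rewrite eq_complex /nsq /=; apply/andP; split; apply/eqP; ring. Qed.

Lemma nsq_conj z : nsq (Num.conj z) = nsq z.
Proof. by case: z => [a b]; rewrite /nsq /=; ring. Qed.

Lemma nsq0 : nsq 0 = 0.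
Proof. by rewrite /nsq /=; ring. Qed.

Lemma nsq1 : nsq 1 = 1.
Proof. by rewrite /nsq /=; ring. Qed.

Lemma nsq_real (x : R) : nsq x%:c = x ^+ 2.
Proof. by rewrite /nsq /=; ring. Qed.

Lemma nsq_eq0 z : nsq z = 0 -> z = 0.
Proof.
case: z => [a b]; rewrite /nsq /= => /eqP.
rewrite paddr_eq0 ?sqr_ge0 // !sqrf_eq0 => /andP[/eqP-> /eqP->] //.
Qed.

Lemma nsq_prod (I : finType) (F : I -> C) :
  nsq (\prod_i F i) = \prod_i nsq (F i).
Proof. exact: (big_morph nsq nsqM nsq1). Qed.

Lemma nsq_add_le z w : nsq (z + w) <= 2 * (nsq z + nsq w).
Proof.
case: z w => [a b] [c d]; rewrite /nsq /=.
have := sqr_ge0 (a - c); have := sqr_ge0 (b - d); nra.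
Qed.

Lemma reD (z w : C) : re (z + w) = re z + re w.
Proof. by case: z w => [a b] [c d]. Qed.
Lemma reN (z : C) : re (- z) = - re z.
Proof. by case: z => [a b]. Qed.
Lemma reB (z w : C) : re (z - w) = re z - re w.
Proof. by rewrite reD reN. Qed.
Lemma reZ (x : R) (z : C) : re (x%:c * z) = x * re z.
Proof. by case: z => [a b]; rewrite /re /=; ring. Qed.
Lemma re_sum (I : Type) (s : seq I) (Q : pred I) (F : I -> C) :
  re (\sum_(i <- s | Q i) F i) = \sum_(i <- s | Q i) re (F i).
Proof. exact: (big_morph _ reD (erefl _)). Qed.
Lemma complex_ge0E (z : C) : (0 <= z) = (complex.Im z == 0) && (0 <= re z).
Proof. by case: z. Qed.

Lemma re_ge0 (z : C) : 0 <= z -> 0 <= re z.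
Proof. by rewrite complex_ge0E => /andP[]. Qed.

Lemma cD (x y : R) : (x + y)%:c = x%:c + y%:c.
Proof. exact: (rmorphD (real_complex R)). Qed.
Lemma cN (x : R) : (- x)%:c = - x%:c.
Proof. exact: (rmorphN (real_complex R)). Qed.
Lemma cM (x y : R) : (x * y)%:c = x%:c * y%:c.
Proof. exact: (rmorphM (real_complex R)). Qed.
Lemma c_sum (I : Type) (s : seq I) (Q : pred I) (F : I -> R) :
  (\sum_(i <- s | Q i) F i)%:c = \sum_(i <- s | Q i) (F i)%:c.
Proof. exact: (rmorph_sum (real_complex R)). Qed.
Lemma c_prod (I : Type) (s : seq I) (Q : pred I) (F : I -> R) :
  (\prod_(i <- s | Q i) F i)%:c = \prod_(i <- s | Q i) (F i)%:c.
Proof. exact: (rmorph_prod (real_complex R)). Qed.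
Lemma conj_c (x : R) : Num.conj (x%:c : C) = x%:c.
Proof. by apply/eqP; rewrite eq_complex /= oppr0 !eqxx. Qed.
Lemma c_ge0 (x : R) : 0 <= x -> 0 <= (x%:c : C).
Proof. by rewrite complex_ge0E eqxx. Qed.

Section Adj.
Implicit Types m n p : nat.
Lemma adjE m n (M : 'M[C]_(m, n)) i j : adj M i j = Num.conj (M j i).
Proof. by rewrite !mxE. Qed.
Lemma adjK m n (M : 'M[C]_(m, n)) : adj (adj M) = M.
Proof. by apply/matrixP => i j; rewrite !adjE conjCK. Qed.
Lemma adjM m n p (A : 'M[C]_(m, n)) (B : 'M[C]_(n, p)) :
  adj (A *m B) = adj B *m adj A.
Proof. by rewrite /adj map_mxM trmx_mul. Qed.
Lemma adjD m n (A B : 'M[C]_(m, n)) : adj (A + B) = adj A + adj B.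
Proof. by rewrite /adj map_mxD linearD. Qed.
Lemma adjN m n (A : 'M[C]_(m, n)) : adj (- A) = - adj A.
Proof. by rewrite /adj map_mxN linearN. Qed.
Lemma adj0 m n : adj (0 : 'M[C]_(m, n)) = 0.
Proof. by rewrite /adj map_mx0 trmx0. Qed.
Lemma adjB m n (A B : 'M[C]_(m, n)) : adj (A - B) = adj A - adj B.
Proof. by rewrite adjD adjN. Qed.
Lemma adjCZ m n c (A : 'M[C]_(m, n)) : adj (c *: A) = Num.conj c *: adj A.
Proof. by rewrite /adj map_mxZ linearZ. Qed.
Lemma adjZr m n (c : R) (A : 'M[C]_(m, n)) : adj (c%:c *: A) = c%:c *: adj A.
Proof. by rewrite adjCZ conj_c. Qed.
Lemma adjC1 n : adj (1%:M : 'M[C]_n) = 1%:M.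
Proof. by rewrite /adj map_mx1 trmx1. Qed.
Lemma adj_sum m n (I : Type) (s : seq I) (Q : pred I) (F : I -> 'M[C]_(m, n)) :
  adj (\sum_(i <- s | Q i) F i) = \sum_(i <- s | Q i) adj (F i).
Proof. by apply: (big_morph _ (@adjD m n)); rewrite adj0. Qed.
Lemma mxtrace_adj n (A : 'M[C]_n) : \tr (adj A) = Num.conj (\tr A).
Proof. by rewrite /adj mxtrace_tr /mxtrace rmorph_sum; apply: eq_bigr => i _; rewrite mxE. Qed.

Definition nrm2 n (v : 'rV[C]_n) : R := \sum_j nsq (v 0 j).

Lemma nrm2_ge0 n (v : 'rV[C]_n) : 0 <= nrm2 v.
Proof. by apply: sumr_ge0 => j _; apply: nsq_ge0. Qed.

Lemma nrm2_eq0 n (v : 'rV[C]_n) : nrm2 v = 0 -> v = 0.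
Proof.
move=> /eqP; rewrite psumr_eq0; last by move=> j _; apply: nsq_ge0.
move=> /allP h; apply/rowP => j; rewrite mxE; apply: nsq_eq0; apply/eqP.
by apply: h; rewrite mem_index_enum.
Qed.

Lemma nrm2E n (v : 'rV[C]_n) : v *m adj v = (nrm2 v)%:c%:M.
Proof.
apply/matrixP => i j; rewrite !ord1 !mxE eqxx mulr1n c_sum.
by apply: eq_bigr => k _; rewrite adjE nsqE.
Qed.

Lemma nrm2E00 n (v : 'rV[C]_n) : (v *m adj v) 0 0 = (nrm2 v)%:c.
Proof. by rewrite nrm2E mxE eqxx. Qed.

Lemma nrm2_unitary n m (v : 'rV[C]_n) (U : 'M[C]_(n, m)) :
  U *m adj U = 1%:M -> nrm2 (v *m U) = nrm2 v.
Proof.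
move=> hU; have := nrm2E00 (v *m U); rewrite adjM mulmxA -(mulmxA v) hU mulmx1.
by rewrite nrm2E00 => -[].
Qed.

Definition dg n (d : 'I_n -> R) : 'M[C]_n := diag_mx (\row_i (d i)%:c).

Lemma adj_dg n (d : 'I_n -> R) : adj (dg d) = dg d.
Proof.
apply/matrixP => i j; rewrite adjE !mxE.
by case: (eqVneq j i) => [->|]; rewrite ?eqxx ?mulr1n ?conj_c // => /negPf; rewrite eq_sym => ->; rewrite !mulr0n conjC0.
Qed.
Lemma dgM n (d e : 'I_n -> R) : dg d *m dg e = dg (fun i => d i * e i).
Proof.
rewrite /dg mulmx_diag; congr diag_mx; apply/rowP => i; rewrite !mxE.
by rewrite cM.
Qed.
Lemma eq_dg n (d e : 'I_n -> R) : d =1 e -> dg d = dg e.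
Proof. by move=> h; congr diag_mx; apply/rowP => i; rewrite !mxE h. Qed.
Lemma dgB n (d e : 'I_n -> R) : dg d - dg e = dg (fun i => d i - e i).
Proof.
rewrite /dg -linearB; congr diag_mx; apply/rowP => i; rewrite !mxE.
by rewrite cD cN.
Qed.
Lemma dgN n (d : 'I_n -> R) : dg (fun i => - d i) = - dg d.
Proof.
by apply/matrixP => i j; rewrite !mxE cN; case: eqP; rewrite ?mulr1n ?mulr0n ?oppr0.
Qed.
Lemma dg1 n : dg (fun _ : 'I_n => 1) = 1%:M.
Proof. by apply/matrixP => i j; rewrite !mxE; case: eqP. Qed.
Lemma mul_dg m n (A : 'M[C]_(m, n)) d i j : (A *m dg d) i j = A i j * (d j)%:c.
Proof. by rewrite mul_mx_diag !mxE. Qed.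
Lemma dg_mul m n (A : 'M[C]_(n, m)) d i j : (dg d *m A) i j = (d i)%:c * A i j.
Proof. by rewrite mul_diag_mx !mxE. Qed.

Lemma psd_nrm2 n (M : 'M[C]_n) : (forall v : 'rV_n, 0 <= (v *m M *m adj v) 0 0) -> psd M.
Proof. by []. Qed.
Lemma psd_mul_adj m n (K : 'M[C]_(n, m)) : psd (K *m adj K).
Proof.
move=> v; rewrite mulmxA -mulmxA -adjM nrm2E00.
by apply: c_ge0; apply: nrm2_ge0.
Qed.
Lemma psdD n (A B : 'M[C]_n) : psd A -> psd B -> psd (A + B).
Proof. by move=> hA hB v; rewrite mulmxDr mulmxDl mxE addr_ge0. Qed.
Lemma psdZ n (c : R) (A : 'M[C]_n) : 0 <= c -> psd A -> psd (c%:c *: A).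
Proof. by move=> hc hA v; rewrite -scalemxAr -scalemxAl mxE mulr_ge0 ?c_ge0. Qed.
Lemma psd0 n : psd (0 : 'M[C]_n).
Proof. by move=> v; rewrite mulmx0 mul0mx mxE. Qed.
Lemma psd1 n : psd (1%:M : 'M[C]_n).
Proof. by move=> v; rewrite mulmx1 nrm2E00; apply/c_ge0/nrm2_ge0. Qed.
Lemma psd_sum n (I : Type) (s : seq I) (Q : pred I) (F : I -> 'M[C]_n) :
  (forall i, Q i -> psd (F i)) -> psd (\sum_(i <- s | Q i) F i).
Proof.
move=> h; elim/big_rec: _ => [|i x hi hx]; first exact: psd0.
exact: (psdD (h i hi) hx).
Qed.
Lemma psd_conj m n (K : 'M[C]_(m, n)) (A : 'M[C]_n) : psd A -> psd (K *m A *m adj K).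
Proof. by move=> hA v; have := hA (v *m K); rewrite adjM !mulmxA. Qed.
Lemma psd_trans n (A B D : 'M[C]_n) : psd (B - A) -> psd (D - B) -> psd (D - A).
Proof. by move=> h1 h2; have := psdD h2 h1; rewrite addrA subrK. Qed.

Lemma mxDE m n (A B : 'M[C]_(m, n)) i j : (A + B) i j = A i j + B i j.
Proof. by rewrite mxE. Qed.
Lemma mxZE m n c (A : 'M[C]_(m, n)) i j : (c *: A) i j = c * A i j.
Proof. by rewrite mxE. Qed.

Lemma mxNE m n (A : 'M[C]_(m, n)) i j : (- A) i j = - A i j.
Proof. by rewrite mxE. Qed.

Lemma bil_delta n (M : 'M[C]_n) i j :
  (delta_mx (0 : 'I_1) i *m M *m adj (delta_mx (0 : 'I_1) j)) 0 0 = M i j.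
Proof.
rewrite -rowE mxE (bigD1 j) //= big1 ?addr0; last first.
  move=> k hk; rewrite adjE !mxE (negPf hk) andbF conjC0 mulr0 //.
by rewrite adjE !mxE !eqxx conjC1 mulr1.
Qed.

(** Polarisation: testing on u + w and on u + i w shows that both the sum and the difference of the
    two mixed terms vanish. *)
Lemma quad_eq0 n (M : 'M[C]_n) :
  (forall v : 'rV_n, (v *m M *m adj v) 0 0 = 0) -> M = 0.
Proof.
move=> h; apply/matrixP => i j; rewrite mxE -bil_delta.
set u := delta_mx 0 i; set w := delta_mx 0 j.
have B (v x : 'rV[C]_n) c : ((v + c *: x) *m M *m adj (v + c *: x)) 0 0 =
   (v *m M *m adj v) 0 0 + Num.conj c * (v *m M *m adj x) 0 0 + c * (x *m M *m adj v) 0 0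
   + c * Num.conj c * (x *m M *m adj x) 0 0.
  rewrite adjD adjCZ !mulmxDl !mulmxDr -!scalemxAl -!scalemxAr -?scalemxAl.
  move: (v *m M *m adj v) (v *m M *m adj x) (x *m M *m adj v) (x *m M *m adj x).
  by move=> p1 p2 p3 p4; rewrite !mxE; ring.
have e1 := B u w 1; have e2 := B u w 'i%C.
rewrite (h (u + _ *: w)) (h u) (h w) in e1; rewrite (h (u + _ *: w)) (h u) (h w) in e2.
move: e1 e2; clear h B; move: ((u *m M *m adj w) 0 0) ((w *m M *m adj u) 0 0) => p q.
rewrite !mulr0 !addr0 !add0r conjC1 !mul1r => e1.
have -> : Num.conj ('i%C : C) = - 'i%C by apply/eqP; rewrite eq_complex /= oppr0 !eqxx.
have {e1} -> : q = - p by apply/eqP; rewrite -addr_eq0 addrC -e1.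
rewrite mulrN mulNr -opprD => /esym/eqP; rewrite oppr_eq0 -mulr2n mulrn_eq0 /= mulf_eq0.
case/orP => [|/eqP//]; rewrite eq_complex /= oner_eq0 andbF //.
Qed.

Lemma psd_herm n (M : 'M[C]_n) : psd M -> adj M = M.
Proof.
move=> h; apply/eqP; rewrite -subr_eq0; apply/eqP; apply: quad_eq0 => v.
rewrite mulmxBr mulmxBl mxE [X in _ + X]mxE.
have -> : v *m adj M *m adj v = adj (v *m M *m adj v) by rewrite !adjM adjK mulmxA.
rewrite adjE; have := h v; case: (_ 0 0) => x y; rewrite complex_ge0E /= => /andP[/eqP-> _].
by rewrite conj_c subrr.
Qed.

(** Any unitary diagonalisation with real eigenvalues, not only the one that [spectralmx] selects;
    tensor products of diagonalisations then qualify again. *)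
Definition spec n (M U : 'M[C]_n) (d : 'I_n -> R) : Prop :=
  U *m adj U = 1%:M /\ M = adj U *m dg d *m U.

Lemma unit_adj n (U : 'M[C]_n) : U *m adj U = 1%:M -> adj U *m U = 1%:M.
Proof. exact: mulmx1C. Qed.

Lemma herm_mx_spec n (M : 'M[C]_n) : adj M = M ->
  exists d : 'I_n -> R, spec M (spectralmx M) d /\ spectral_diag M = \row_i (d i)%:c.
Proof.
move=> hM.
have hh : M \is hermsymmx.
  by rewrite qualifE /= expr0 scale1r -map_trmx -/(adj M) hM.
have := orthomx_spectralP (hermitian_normalmx hh) => /= e.
have hr := hermitian_spectral_diag_real hh.
have hu := spectral_unitarymx M.
pose d := fun i => re (spectral_diag M 0 i).
have hd : spectral_diag M = \row_i (d i)%:c.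
  apply/rowP => i; rewrite mxE /d.
  move: hr => /mxOverP/(_ 0 i); case: (spectral_diag M 0 i) => x y.
  by rewrite complex_real => /eqP /= ->.
exists d; split; last by []; split.
  by rewrite -(unitarymxP hu) /adj map_trmx.
apply: etrans e _; by rewrite (invmx_unitary hu) -map_trmx -/(adj _) hd.
Qed.

Lemma herm_spec n (M : 'M[C]_n) : adj M = M -> exists U d, spec M U d.
Proof. by case/herm_mx_spec => d [h _]; exists (spectralmx M), d. Qed.

(** Entry (i, j) of the hypothesis reads (d_i - e_j) W_ij = 0: where W_ij is nonzero the eigenvalues
    agree, hence so do their images under an arbitrary f. *)
Lemma intertwine n (W : 'M[C]_n) (d e : 'I_n -> R) (f : R -> R) :
  dg d *m W = W *m dg e -> dg (f \o d) *m W = W *m dg (f \o e).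
Proof.
move=> h; apply/matrixP => i j; rewrite dg_mul mul_dg /=.
have /matrixP/(_ i j) := h; rewrite dg_mul mul_dg => /eqP.
rewrite mulrC -subr_eq0 -mulrBr mulf_eq0 => /orP[/eqP->|]; first by rewrite mulr0 mul0r.
by rewrite subr_eq0 => /eqP[->]; rewrite mulrC.
Qed.

(** Serves twice: with V = U, f(M) commutes with whatever commutes with M; with X = 1, f(M) does not
    depend on the diagonalisation. *)
Lemma spec_commute n (M U V X : 'M[C]_n) d e f :
  spec M U d -> V *m adj V = 1%:M -> M *m X = X *m (adj V *m dg e *m V) ->
  (adj U *m dg (f \o d) *m U) *m X = X *m (adj V *m dg (f \o e) *m V).
Proof.
move=> [hU ->] hV h; have hU' := unit_adj hU; have hV' := unit_adj hV.
have : dg (f \o d) *m (U *m X *m adj V) = (U *m X *m adj V) *m dg (f \o e).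
  apply: intertwine; transitivity (U *m (adj U *m dg d *m U *m X) *m adj V).
    by rewrite !mulmxA hU mul1mx.
  by rewrite h -!mulmxA hV mulmx1.
move=> /(congr1 (fun Y => adj U *m Y *m V)); rewrite !mulmxA => e1.
by rewrite -[LHS]mulmx1 -hV' !mulmxA e1 hU' mul1mx.
Qed.

Lemma mxfun_spec n (M U : 'M[C]_n) d f :
  spec M U d -> mxfun f M = adj U *m dg (f \o d) *m U.
Proof.
move=> [hU hM].
have hH : adj M = M by rewrite hM !adjM adjK adj_dg mulmxA.
have [e [hs he]] := herm_mx_spec hH.
have hu := spectral_unitarymx M.
rewrite /mxfun (invmx_unitary hu) -map_trmx -/(adj _) he.
have -> : diag_mx (map_mx (fun z : C => (f (re z))%:c) (\row_i (e i)%:c)) = dg (f \o e).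
  by congr diag_mx; apply/rowP => i; rewrite !mxE.
have h := @spec_commute _ _ _ U 1%:M _ d f hs hU.
by rewrite !mulmx1 !mul1mx in h; apply: h.
Qed.

Lemma spec_comm n (M U X : 'M[C]_n) d f : spec M U d -> M *m X = X *m M ->
  (adj U *m dg (f \o d) *m U) *m X = X *m (adj U *m dg (f \o d) *m U).
Proof. by move=> hs h; apply: spec_commute (hs) _ _; case: hs => // hU <-. Qed.

Lemma spec_entry n (M U : 'M[C]_n) d i : spec M U d ->
  (d i)%:c = (row i U *m M *m adj (row i U)) 0 0.
Proof.
move=> [hU ->].
have h1 : row i U *m adj U = delta_mx 0 i by rewrite -row_mul hU row1.
have h2 : U *m adj (row i U) = adj (delta_mx 0 i) by rewrite -h1 adjM adjK.
by rewrite !mulmxA h1 -!mulmxA h2 mulmxA bil_delta !mxE eqxx.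
Qed.

Lemma psd_spec n (M : 'M[C]_n) : psd M ->
  exists U d, spec M U d /\ forall i, 0 <= d i.
Proof.
move=> h; have [U [d hs]] := herm_spec (psd_herm h).
exists U, d; split => // i; have := h (row i U).
by rewrite -(spec_entry _ hs) complex_ge0E => /andP[].
Qed.

Lemma spec_psd n (M U : 'M[C]_n) d : spec M U d -> (forall i, 0 <= d i) -> psd M.
Proof.
move=> [hU ->] hd.
have -> : adj U *m dg d *m U =
    (adj U *m dg (fun i => Num.sqrt (d i))) *m adj (adj U *m dg (fun i => Num.sqrt (d i))).
  rewrite adjM adjK adj_dg !mulmxA -(mulmxA _ (dg _) (dg _)) dgM; congr (_ *m _ *m _).
  by apply: eq_dg => i; rewrite -expr2 sqr_sqrtr.
exact: psd_mul_adj.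
Qed.

Lemma psd_sqrt n (M : 'M[C]_n) : psd M -> exists K : 'M[C]_n,
  [/\ adj K = K, K *m K = M & forall X, M *m X = X *m M -> K *m X = X *m K].
Proof.
move=> /psd_spec [U [d [hs hd]]]; exists (adj U *m dg (Num.sqrt \o d) *m U); split.
- by rewrite !adjM adjK adj_dg mulmxA.
- case: hs => hU ->; rewrite !mulmxA -(mulmxA _ U) hU mulmx1 -(mulmxA _ (dg _) (dg _)) dgM.
  by congr (_ *m _ *m _); apply: eq_dg => i; rewrite /= -expr2 sqr_sqrtr.
- by move=> X; apply: spec_comm.
Qed.

Lemma tr_psd_ge0 n (A : 'M[C]_n) : psd A -> 0 <= re (\tr A).
Proof.
move=> h; rewrite re_sum; apply: sumr_ge0 => i _; apply: re_ge0.
by rewrite -bil_delta; apply: h.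
Qed.

Lemma tr_psd_mulC n (A B : 'M[C]_n) : psd A -> psd B -> 0 <= \tr (A *m B).
Proof.
move=> /psd_sqrt [K [hK <- _]] hB; rewrite -mulmxA mxtrace_mulC.
have h := psd_conj K hB; rewrite hK in h.
by rewrite /mxtrace; apply: sumr_ge0 => i _; rewrite -bil_delta; apply: h.
Qed.

Lemma tr_psd_mul n (A B : 'M[C]_n) : psd A -> psd B -> 0 <= re (\tr (A *m B)).
Proof. by move=> hA hB; apply/re_ge0/tr_psd_mulC. Qed.

(** Positivity in trace form, which is the form that the duality of partial traces delivers. *)
Lemma tr_psd_psd n (M : 'M[C]_n) :
  (forall K : 'cV[C]_n, 0 <= \tr (M *m (K *m adj K))) -> psd M.
Proof.
move=> h v; have := h (adj v); rewrite adjK mulmxA mxtrace_mulC mulmxA.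
by rewrite /mxtrace big_ord1.
Qed.

Lemma tr_psd_le n (A A' B : 'M[C]_n) : psd (A' - A) -> psd B ->
  re (\tr (A *m B)) <= re (\tr (A' *m B)).
Proof.
by move=> hA hB; rewrite -subr_ge0 -reB -raddfB -mulmxBl; apply: tr_psd_mul.
Qed.

End Adj.
End LinAlg.

Opaque psd adj.

(** * One-shot error bounds *)

Section OneShot.
Variable R : realType.
Local Notation C := R[i].
Local Notation "x %:c" := (Complex x (0:R)) (at level 2, format "x %:c").

Lemma tr_psd_le_r n (A B B' : 'M[C]_n) : psd A -> psd (B' - B) ->
  re (\tr (A *m B)) <= re (\tr (A *m B')).
Proof.
by move=> hA hB; rewrite -subr_ge0 -reB -raddfB -mulmxBr; apply: tr_psd_mul.
Qed.

(** T - T^2 = T (1 - T) T + (1 - T) T (1 - T), and both summands are positive. *)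
Lemma test_sqr n (T : 'M[C]_n) : psd T -> psd (1%:M - T) -> psd (T - T *m T).
Proof.
move=> h1 h2; have e1 := psd_herm h1; have e2 := psd_herm h2.
have := psdD (psd_conj T h2) (psd_conj (1%:M - T) h1); rewrite e1 e2.
congr psd; rewrite !(mulmxBl, mulmxBr, mul1mx, mulmx1).
by apply/matrixP=> i j; rewrite !(mxDE, mxNE); ring.
Qed.

Lemma mxtrace_conj n (U D M : 'M[C]_n) :
  \tr (adj U *m D *m U *m M) = \tr (D *m (U *m M *m adj U)).
Proof.
rewrite -(mulmxA (adj U)) -(mulmxA (adj U)) mxtrace_mulC; congr (\tr _).
by rewrite -!mulmxA.
Qed.

Lemma tr_spec n (A U X : 'M[C]_n) r : spec A U r ->
  re (\tr (A *m (X *m adj X))) = \sum_i r i * nrm2 (row i (U *m X)).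
Proof.
move=> [hU ->]; rewrite mxtrace_conj.
have -> : U *m (X *m adj X) *m adj U = (U *m X) *m adj (U *m X).
  by rewrite adjM !mulmxA.
rewrite re_sum; apply: eq_bigr => i _.
rewrite dg_mul reZ; congr (_ * _).
have -> : ((U *m X) *m adj (U *m X)) i i = (row i (U *m X) *m adj (row i (U *m X))) 0 0.
  rewrite !mxE; apply: eq_bigr => k _; rewrite !adjE !mxE //.
by rewrite nrm2E00.
Qed.

Lemma nrm2_row_unitary n (U X W : 'M[C]_n) i : W *m adj W = 1%:M ->
  nrm2 (row i (U *m X)) = \sum_j nsq ((U *m X *m adj W) i j).
Proof.
move=> hW; rewrite -(@nrm2_unitary _ n n _ (adj W)) ?adjK ?unit_adj //.
by rewrite /nrm2; apply: eq_bigr => j _; rewrite -row_mul mxE.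
Qed.

(* The weights [r i * nsq ((U *m adj W) i j)] and [s j * nsq ((U *m adj W) i j)]
   are the Nussbaum-Szkola distributions of [A] and [B]. *)
Lemma nussbaum_szkola_lower n (A B U W T : 'M[C]_n) r s lam :
  spec A U r -> spec B W s -> (forall i, 0 <= r i) -> (forall i, 0 <= s i) ->
  0 <= lam -> psd T -> psd (1%:M - T) ->
  \sum_i \sum_j nsq ((U *m adj W) i j) * Num.min (r i) (lam * s j) <=
  2 * (re (\tr (A *m (1%:M - T))) + lam * re (\tr (B *m T))).
Proof.
move=> hA hB hr hs hlam h1 h2.
have e1 := psd_herm h1; have e2 := psd_herm h2.
have hU := hA.1; have hW := hB.1.
pose a i j := nsq ((U *m (1%:M - T) *m adj W) i j).
pose b i j := nsq ((U *m T *m adj W) i j).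
(* As (1 - T)^2 <= 1 - T, the type-I error dominates a weighted sum of squared entries; likewise T^2
   <= T below. *)
have h3 : \sum_i \sum_j r i * a i j <= re (\tr (A *m (1%:M - T))).
  have h4 : psd ((1%:M - T) - (1%:M - T) *m adj (1%:M - T)).
    rewrite e2; apply: (test_sqr h2).
    by have -> : 1%:M - (1%:M - T) = T by rewrite opprB addrC subrK.
  have := tr_psd_le_r (spec_psd hA hr) h4; apply: le_trans.
  rewrite (tr_spec _ hA) le_eqVlt; apply/orP; left; apply/eqP; apply: eq_bigr => i _.
  by rewrite (nrm2_row_unitary _ _ _ hW) mulr_sumr.
have h4 : \sum_i \sum_j s j * b i j <= re (\tr (B *m T)).
  have h5 : psd (T - T *m adj T) by rewrite e1; apply: test_sqr.
  have := tr_psd_le_r (spec_psd hB hs) h5; apply: le_trans.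
  rewrite (tr_spec _ hB) exchange_big le_eqVlt; apply/orP; left; apply/eqP; apply: eq_bigr => j _.
  rewrite (nrm2_row_unitary _ _ _ hU) mulr_sumr; apply: eq_bigr => i _.
  by rewrite -nsq_conj -adjE !adjM adjK e1 mulmxA.
apply: (@le_trans _ _ (2 * (\sum_i \sum_j (r i * a i j + lam * (s j * b i j))))); last first.
  rewrite ler_pM2l //; apply: le_trans (lerD h3 (ler_wpM2l hlam h4)).
  rewrite le_eqVlt; apply/orP; left; apply/eqP.
  rewrite mulr_sumr -big_split; apply: eq_bigr => i _ /=.
  by rewrite mulr_sumr -big_split.
rewrite mulr_sumr; apply: ler_sum => i _; rewrite mulr_sumr; apply: ler_sum => j _.
(* Splits 1 into (1 - T) + T; this is the only source of the factor 2. *)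
have h6 : nsq ((U *m adj W) i j) <= 2 * (a i j + b i j).
  apply: le_trans (nsq_add_le _ _).
  by rewrite -mxDE -mulmxDl -mulmxDr subrK mulmx1.
have ha : 0 <= a i j := nsq_ge0 _. have hb : 0 <= b i j := nsq_ge0 _.
have m1 : Num.min (r i) (lam * s j) <= r i by rewrite ge_min lexx.
have m2 : Num.min (r i) (lam * s j) <= lam * s j by rewrite ge_min lexx orbT.
have m0 : 0 <= Num.min (r i) (lam * s j) by rewrite le_min hr mulr_ge0.
set m := Num.min _ _ in m0 m1 m2 *.
have := ler_wpM2r m0 h6; have := ler_wpM2l ha m1; have := ler_wpM2l hb m2; nra.
Qed.

Lemma proj_psd n (P : 'M[C]_n) : adj P = P -> P *m P = P -> psd P /\ psd (1%:M - P).
Proof.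
move=> h1 h2; split; first by rewrite -h2 -{2}h1; apply: psd_mul_adj.
suff -> : 1%:M - P = (1%:M - P) *m adj (1%:M - P) by apply: psd_mul_adj.
by rewrite adjB adjC1 h1 !(mulmxBl, mulmxBr, mul1mx, mulmx1) h2 subrr subr0.
Qed.

Section Achievability.
Variables (n : nat) (U W : 'M[C]_n) (r s : 'I_n -> R) (lam : R).
Hypotheses (hU : U *m adj U = 1%:M) (hW : W *m adj W = 1%:M).
Hypotheses (hr : forall i, 0 <= r i) (hs : forall i, 0 <= s i) (hlam : 0 < lam).

Let G (c : R) : 'M[C]_n := adj W *m dg (fun j => if lam * s j < c then 1 else 0 : R) *m W.
Let B : 'M[C]_n := adj W *m dg s *m W.

Lemma cutG c d : c <= d -> G c *m G d = G c.
Proof.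
move=> hcd; rewrite /G !mulmxA -(mulmxA _ W) hW mulmx1 -(mulmxA _ (dg _) (dg _)) dgM.
congr (_ *m _ *m _); apply: eq_dg => i; case: (ltP (lam * s i) c) => h; rewrite ?mul0r //.
by rewrite (lt_le_trans h hcd) mulr1.
Qed.

Lemma cutG_quad c (w : 'rV[C]_n) : w *m G c = w -> 0 <= c ->
  lam * re ((w *m B *m adj w) 0 0) <= c * nrm2 w.
Proof.
move=> hw hc.
have hwW : forall j, (w *m adj W) 0 j != 0 -> lam * s j < c.
  move=> j; rewrite -{1}hw /G !mulmxA -mulmxA hW mulmx1 mul_dg.
  by case: (ltP (lam * s j) c) => //; rewrite mulr0 eqxx.
have -> : (w *m B *m adj w) 0 0 = ((w *m adj W) *m dg s *m adj (w *m adj W)) 0 0.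
  by rewrite /B adjM adjK !mulmxA.
have hn : nrm2 w = nrm2 (w *m adj W) by rewrite nrm2_unitary // adjK unit_adj.
rewrite hn; set y := w *m adj W in hwW *.
rewrite mxE re_sum /nrm2 !mulr_sumr; apply: ler_sum => j _.
rewrite mul_dg adjE (mulrC (y 0 j)) -mulrA -nsqE -cM [re _]/= mulrA.
have [->|/hwW h] := eqVneq (y 0 j) 0; first by rewrite nsq0 !mulr0.
by rewrite ler_wpM2r ?nsq_ge0 // ltW.
Qed.

(* [T] projects onto the span of the vectors [e_i G_(r_i)], orthonormalised in
   increasing order of [r_i]: the new direction then lies in the range of
   [G_(r_i)], where [lam *: B <= r_i]. *)
Lemma greedy_proj (l : seq 'I_n) : sorted (fun i j => r j <= r i) l ->
  exists T : 'M[C]_n, [/\ adj T = T, T *m T = T,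
    (forall i, i \in l -> (row i U *m G (r i)) *m T = row i U *m G (r i)),
    (forall c, (forall i, i \in l -> r i <= c) -> T *m G c = T) &
    lam * re (\tr (B *m T)) <= \sum_(i <- l) r i].
Proof.
elim: l => [_|i l IH hsort].
  exists 0; split; rewrite ?adj0 ?mulmx0 //.
  - by move=> c _; rewrite mul0mx.
  - by rewrite big_nil mxtrace0 mulr0.
have htr : transitive (fun i j => r j <= r i) by move=> x y z h1 h2; apply: le_trans h1.
have hle : forall j, j \in l -> r j <= r i by apply/allP; apply: order_path_min hsort.
have [T [T1 T2 T3 T4 T5]] := IH (path_sorted hsort).
have [v vE] : exists v, v = row i U *m G (r i) by eexists.
(* Gram-Schmidt residue of v. The earlier directions lie in ranges of G_c with c <= r_i, all
   contained in the range of G_(r_i), so w stays in that range. *)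
pose w := v - v *m T.
have hwT : w *m T = 0 by rewrite /w mulmxBl -(mulmxA v) T2 subrr.
have hTw : T *m adj w = 0 by rewrite -{1}T1 -adjM hwT adj0.
have hwG c : r i <= c -> w *m G c = w.
  move=> hc; rewrite /w mulmxBl {1}vE -(mulmxA v) -(mulmxA _ (G _)) (cutG hc) -vE T4 // => j hj.
  exact: le_trans (hle j hj) hc.
have [hw|hw] := eqVneq (nrm2 w) 0.
  have w0 : w = 0 by apply: nrm2_eq0.
  have hv : v *m T = v by apply/eqP; rewrite eq_sym -subr_eq0 -/w w0.
  exists T; split.
  - exact: T1.
  - exact: T2.
  - by move=> j; rewrite inE => /orP[/eqP->|]; [rewrite -vE|apply: T3].
  - by move=> c hc; apply: T4 => j hj; apply: hc; rewrite inE hj orbT.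
  - by rewrite big_cons; apply: le_trans T5 _; rewrite lerDr.
set N := nrm2 w in hw *.
have hN : 0 < N by rewrite lt_neqAle eq_sym hw nrm2_ge0.
pose E := (N^-1)%:c *: (adj w *m w).
have E1 : adj E = E by rewrite /E adjZr adjM adjK.
have E2 : E *m E = E.
  rewrite /E -scalemxAl -scalemxAr mulmxA -(mulmxA _ w) nrm2E -/N.
  rewrite mul_mx_scalar -scalemxAl !scalerA -!cM; congr (_ %:c *: _).
  by rewrite mulVf // mulr1.
have ET : E *m T = 0 by rewrite /E -scalemxAl -mulmxA hwT mulmx0 scaler0.
have TE : T *m E = 0 by rewrite /E -scalemxAr mulmxA hTw mul0mx scaler0.
have hvw : v *m adj w = N%:c%:M.
  have -> : v = w + v *m T by rewrite /w subrK.
  by rewrite mulmxDl -(mulmxA v) hTw mulmx0 addr0 nrm2E.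
exists (T + E); split.
- by rewrite adjD T1 E1.
- by rewrite mulmxDl !mulmxDr T2 E2 ET TE addr0 add0r.
- move=> j; rewrite inE => /orP[/eqP->|hj].
    rewrite -vE mulmxDr /E -scalemxAr mulmxA hvw mul_scalar_mx scalerA -cM mulVf //.
    by rewrite scale1r /w addrC subrK.
  have h0 : row j U *m G (r j) *m E = 0 by rewrite -(T3 j hj) -(mulmxA _ T E) TE mulmx0.
  by rewrite mulmxDr h0 addr0; apply: T3.
- move=> c hc; rewrite mulmxDl T4 => [|j hj]; last by apply: hc; rewrite inE hj orbT.
  by rewrite /E -scalemxAl -mulmxA hwG // hc // inE eqxx.
- rewrite big_cons mulmxDr mxtraceD reD mulrDr addrC lerD //.
  rewrite /E -scalemxAr mxtraceZ reZ mulmxA mxtrace_mulC mulmxA.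
  have -> : \tr (w *m B *m adj w) = (w *m B *m adj w) 0 0 by rewrite /mxtrace big_ord1.
  rewrite mulrCA ler_pdivrMl // mulrC [leRHS]mulrC.
  rewrite mulrC; apply: cutG_quad => //; exact: hwG.
Qed.

(** Write e_i for row i of U. As T fixes e_i G_(r_i), e_i (1 - T) = e_i (1 - G_(r_i)) (1 - T) is no
    longer than e_i (1 - G_(r_i)); expanded in the basis [W], the latter collects exactly the j with
    r_i <= lam s_j. *)
Lemma nussbaum_szkola_test : exists T : 'M[C]_n, [/\ psd T, psd (1%:M - T),
   re (\tr ((adj U *m dg r *m U) *m (1%:M - T))) <=
     \sum_i \sum_(j | r i <= lam * s j) r i * nsq ((U *m adj W) i j) &
   lam * re (\tr (B *m T)) <= \sum_i r i].
Proof.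
pose l := sort (fun i j => r j <= r i) (enum 'I_n).
have hl : sorted (fun i j => r j <= r i) l by apply: sort_sorted => x y; apply: le_total.
have [T [T1 T2 T3 _ T5]] := greedy_proj hl.
have [p1 p2] := proj_psd T1 T2.
exists T; split => //; last first.
  apply: le_trans T5 _; rewrite le_eqVlt; apply/orP; left; apply/eqP.
  rewrite (perm_big (enum 'I_n)); last by rewrite perm_sort.
  by rewrite big_enum.
have Q1 : adj (1%:M - T) = 1%:M - T by rewrite adjB adjC1 T1.
have Q2 : (1%:M - T) *m adj (1%:M - T) = 1%:M - T.
  by rewrite Q1 !(mulmxBl, mulmxBr, mul1mx, mulmx1) T2 subrr subr0.
rewrite -[X in _ *m X]Q2 (@tr_spec _ _ U _ r) //.
apply: ler_sum => i _; rewrite -mulr_sumr; apply: ler_wpM2l => //.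
have -> : row i (U *m (1%:M - T)) = row i (U *m (1%:M - G (r i))) *m (1%:M - T).
  rewrite !row_mul.
  have -> : row i U *m (1%:M - G (r i)) = row i U - row i U *m G (r i) by rewrite mulmxBr mulmx1.
  rewrite [RHS]mulmxBl.
  have -> : row i U *m G (r i) *m (1%:M - T) = 0.
    by rewrite mulmxBr mulmx1 T3 ?subrr // mem_sort mem_enum.
  by rewrite subr0.
apply: (@le_trans _ _ (nrm2 (row i (U *m (1%:M - G (r i)))))).
  set y := row _ _.
  have : (y *m (1%:M - T)) *m adj (y *m (1%:M - T)) = y *m adj y - (y *m T) *m adj (y *m T).
    rewrite adjM mulmxA -(mulmxA y) Q2 !adjM T1 mulmxA -(mulmxA y T T) T2.
    by rewrite mulmxBr mulmx1 mulmxBl.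
  move=> /(congr1 (fun M : 'M[C]_1 => re (M 0 0))); rewrite mxDE mxNE reB !nrm2E00 /= => ->.
  by rewrite gerBl; apply: nrm2_ge0.
rewrite (nrm2_row_unitary _ _ _ hW).
rewrite [leRHS]big_mkcond /=; apply: ler_sum => j _.
have -> : U *m (1%:M - G (r i)) *m adj W = (U *m adj W) *m dg (fun j => 1 - (if lam * s j < r i then 1 else 0 : R)).
  rewrite -dgB dg1 /G !mulmxBr !mulmxBl !mulmx1; congr (_ - _).
  by rewrite !mulmxA -(mulmxA _ W) hW mulmx1.
rewrite mul_dg nsqM nsq_real; case: (ltP (lam * s j) (r i)) => h.
  by rewrite subrr expr0n /= mulr0.
by rewrite subr0 expr1n mulr1.
Qed.

End Achievability.

(** An operator Markov inequality. [P] projects onto the nonpositive part of Om - K H. Since Om and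
    H commute, [P] commutes with both; off its range K H is at most Om, so the mass of H there is at
    most tr Om / K. *)
Lemma spectral_cut n (Om H : 'M[C]_n) (K : R) : psd Om -> psd H ->
  Om *m H = H *m Om -> 0 <= K ->
  exists P : 'M[C]_n, [/\ adj P = P, P *m P = P,
    psd (K%:c *: H - P *m Om *m P) & K * re (\tr (H *m (1%:M - P))) <= re (\tr Om)].
Proof.
move=> hO hH hc hK; pose D := Om - K%:c *: H.
have hD : adj D = D by rewrite adjB adjZr !psd_herm.
have [U [d hs]] := herm_spec hD.
pose f (x : R) : R := if x <= 0 then 1 else 0.
pose P := adj U *m dg (f \o d) *m U.
have hU := hs.1.
have P1 : adj P = P by rewrite /P !adjM adjK adj_dg mulmxA.
have P2 : P *m P = P.
  rewrite /P !mulmxA -(mulmxA _ U) hU mulmx1 -(mulmxA _ (dg _) (dg _)) dgM.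
  by congr (_ *m _ *m _); apply: eq_dg => i; rewrite /= /f; case: (_ <= _); rewrite ?mulr1 ?mulr0.
have hPX X : D *m X = X *m D -> P *m X = X *m P by apply: spec_comm.
have PH : P *m H = H *m P.
  by apply: hPX; rewrite /D mulmxBl mulmxBr hc -scalemxAl -scalemxAr.
have PO : P *m Om = Om *m P.
  by apply: hPX; rewrite /D mulmxBl mulmxBr -scalemxAl -scalemxAr hc.
have PD : D *m P = adj U *m dg (fun i => d i * f (d i)) *m U.
  by rewrite hs.2 /P !mulmxA -(mulmxA _ U) hU mulmx1 -(mulmxA _ (dg _) (dg _)) dgM.
have psdN : psd (- (D *m P)).
  apply: (@spec_psd _ _ _ U (fun i => - (d i * f (d i)))).
    split; first exact: hU.
    rewrite PD; set e := fun i => d i * _.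
    rewrite dgN.
    by rewrite mulmxN mulNmx.
  move=> i; rewrite /f; case: (leP (d i) 0) => h; rewrite ?mulr1 ?mulr0; lra.
have psdQ : psd (D *m (1%:M - P)).
  apply: (@spec_psd _ _ _ U (fun i => d i - d i * f (d i))).
    by split; [exact: hU|]; rewrite mulmxBr mulmx1 PD {1}hs.2 -dgB mulmxBr mulmxBl.
  move=> i; rewrite /f; case: (leP (d i) 0) => h; rewrite ?mulr1 ?mulr0; lra.
have hOm : Om = D + K%:c *: H by rewrite /D subrK.
clearbody P D.
have hPOP : P *m Om *m P = D *m P + K%:c *: (H *m P).
  by rewrite PO -mulmxA P2 {1}hOm mulmxDl -scalemxAl.
have hQ : (1%:M - P) *m H *m adj (1%:M - P) = H - H *m P.
  rewrite adjB adjC1 P1 mulmxBr mulmx1 mulmxBl mul1mx PH mulmxBl -(mulmxA H) P2.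
  by rewrite subrr subr0.
have [pP pQ] := proj_psd P1 P2.
exists P; split.
- exact: P1.
- exact: P2.
(* On the range of P the difference is K H - Om, which is positive there; off it, K H itself
   remains. *)
- have -> : K%:c *: H - P *m Om *m P = - (D *m P) + K%:c *: ((1%:M - P) *m H *m adj (1%:M - P)).
    by rewrite hPOP hQ; apply/matrixP=> i j; rewrite !(mxDE, mxNE, mxZE); ring.
  exact: psdD psdN (psdZ hK (psd_conj _ hH)).
- apply: (@le_trans _ _ (re (\tr (Om *m (1%:M - P))))).
    rewrite {1}hOm mulmxDl mxtraceD reD -scalemxAl mxtraceZ reZ lerDr.
    exact: tr_psd_ge0.
  rewrite mulmxBr mulmx1 linearB /= reB gerBl; exact: tr_psd_mul.
Qed.

(** The bound is linear in both errors; a square-root loss would halve the exponent. With X = 1 - T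
    and Q = 1 - P, the constants come from the identity 2 X + 3 Q - (1 - P T P) = (1 + Q) X (1 + Q)
    + 2 Q T Q, whose right side is positive. *)
Lemma gentle n (A T P : 'M[C]_n) : psd A -> psd T -> psd (1%:M - T) ->
  adj P = P -> P *m P = P ->
  re (\tr (A *m (1%:M - P *m T *m P))) <=
  2 * re (\tr (A *m (1%:M - T))) + 3 * re (\tr (A *m (1%:M - P))).
Proof.
move=> hA hT hT' P1 P2.
have [_ pQ] := proj_psd P1 P2; move: pQ hT'.
have [Q QE] : exists Q, Q = 1%:M - P by eexists.
have [X XE] : exists X, X = 1%:M - T by eexists.
rewrite -QE -XE => pQ hX.
have Q1 : adj Q = Q by apply: psd_herm.
have -> : 2 * re (\tr (A *m X)) + 3 * re (\tr (A *m Q)) = re (\tr (A *m (2%:c *: X + 3%:c *: Q))).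
  by rewrite (mulmxDr A (_ *: X)) -!scalemxAr mxtraceD !mxtraceZ reD !reZ.
apply: (tr_psd_le_r hA).
have -> : 2%:c *: X + 3%:c *: Q - (1%:M - P *m T *m P) =
    (1%:M + Q) *m X *m adj (1%:M + Q) + 2%:c *: (Q *m T *m adj Q).
  rewrite adjD adjC1 Q1.
  have -> : T = 1%:M - X by rewrite XE opprB addrC subrK.
  have -> : P = 1%:M - Q by rewrite QE opprB addrC subrK.
  have QQ : Q *m Q = Q by rewrite QE !(mulmxBl, mulmxBr, mul1mx, mulmx1) P2 subrr subr0.
  rewrite !(mulmxBl, mulmxBr, mulmxDl, mulmxDr, mul1mx, mulmx1, mulmxN, mulNmx) QQ.
  have -> : 2%:c = 2 :> C by apply/eqP; rewrite eq_complex /= addr0 !eqxx.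
  have -> : 3%:c = 3 :> C by apply/eqP; rewrite eq_complex /= !addr0 !eqxx.
  by apply/matrixP=> i j; rewrite !(mxDE, mxNE, mxZE); ring.
exact: psdD (psd_conj _ hX) (psdZ _ (psd_conj _ hT)).
Qed.

End OneShot.

(** * Tensor powers and partial traces *)

Section Labels.
Variable R : realType.
Local Notation C := R[i].
Local Notation "x %:c" := (Complex x (0:R)) (at level 2, format "x %:c").
Implicit Types T TA TB : finType.

Lemma sum_op_enum (V : nmodType) T (F : 'I_#|T| -> V) :
  \sum_i F i = \sum_(x : T) F (enum_rank x).
Proof. by rewrite (reindex enum_rank) //=; apply: onW_bij; apply: enum_rank_bij. Qed.

Lemma sum_op_enum_cond (V : nmodType) T (Q : pred 'I_#|T|) (F : 'I_#|T| -> V) :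
  \sum_(i | Q i) F i = \sum_(x : T | Q (enum_rank x)) F (enum_rank x).
Proof. by rewrite big_mkcond sum_op_enum [RHS]big_mkcond. Qed.

Lemma entry_mkop T (f : T -> T -> C) x y : entry (mkop f) x y = f x y.
Proof. by rewrite /entry mxE !enum_rankK. Qed.

Lemma opP T (M N : op R T) : (forall x y, entry M x y = entry N x y) -> M = N.
Proof.
move=> h; apply/matrixP => i j; have := h (enum_val i) (enum_val j).
by rewrite /entry !enum_valK.
Qed.

Lemma entry_mul T (M N : op R T) x y :
  entry (M *m N) x y = \sum_z entry M x z * entry N z y.
Proof. by rewrite /entry mxE sum_op_enum. Qed.

Lemma entry_adj T (M : op R T) x y : entry (adj M) x y = Num.conj (entry M y x).
Proof. by rewrite /entry adjE. Qed.

Lemma entry1 T x y : entry (1%:M : op R T) x y = (x == y)%:R.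
Proof. by rewrite /entry mxE (inj_eq enum_rank_inj). Qed.

Lemma entryB T (M N : op R T) x y : entry (M - N) x y = entry M x y - entry N x y.
Proof. by rewrite /entry mxDE mxNE. Qed.

Lemma entryZ T c (M : op R T) x y : entry (c *: M) x y = c * entry M x y.
Proof. by rewrite /entry mxZE. Qed.

Lemma entry0 T x y : entry (0 : op R T) x y = 0.
Proof. by rewrite /entry mxE. Qed.

Lemma entry_sum T (I : Type) (s : seq I) (Q : pred I) (F : I -> op R T) x y :
  entry (\sum_(i <- s | Q i) F i) x y = \sum_(i <- s | Q i) entry (F i) x y.
Proof. by rewrite /entry summxE. Qed.

Lemma tr_entry T (M : op R T) : \tr M = \sum_x entry M x x.
Proof. by rewrite /mxtrace sum_op_enum. Qed.

Definition dgT T (d : T -> R) : op R T := dg (d \o enum_val).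

Lemma entry_dgT T (d : T -> R) x y : entry (dgT d) x y = (d x)%:c *+ (x == y).
Proof. by rewrite /entry !mxE /= (inj_eq enum_rank_inj) enum_rankK. Qed.

Definition specT T (M U : op R T) (d : T -> R) := spec M U (d \o enum_val).

Lemma psd_specT T (M : op R T) : psd M ->
  exists U d, specT M U d /\ forall x, 0 <= d x.
Proof.
move=> /psd_spec [U [d [h h0]]]; exists U, (d \o enum_rank); split; last by move=> x; apply: h0.
move: h; rewrite /specT; congr spec; apply/funext => i /=; by rewrite enum_valK.
Qed.

Lemma sum_pair (V : nmodType) TA TB (F : (TA * TB)%type -> V) :
  \sum_z F z = \sum_a \sum_b F (a, b).
Proof. by rewrite pair_bigA; apply: eq_bigr => -[]. Qed.

Lemma sum_ffun_pair (V : nmodType) TA TB n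
  (F : {ffun 'I_n -> TA} -> {ffun 'I_n -> TB} -> V) :
  \sum_(x : {ffun 'I_n -> (TA * TB)%type}) F [ffun k => (x k).1] [ffun k => (x k).2] =
  \sum_f \sum_g F f g.
Proof.
rewrite pair_bigA /= (reindex (fun p : {ffun 'I_n -> TA} * {ffun 'I_n -> TB} =>
   [ffun k => (p.1 k, p.2 k)])) /=.
  apply: eq_bigr => -[f g] _ /=; congr F; apply/ffunP => k; by rewrite !ffunE.
exists (fun x : {ffun 'I_n -> (TA * TB)%type} => ([ffun k => (x k).1], [ffun k => (x k).2])).
  by move=> [f g] _ /=; congr pair; apply/ffunP => k; rewrite !ffunE.
by move=> x _; apply/ffunP => k; rewrite !ffunE /=; case: (x k).
Qed.

Lemma entry_tpow T n (M : op R T) x y :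
  entry (tpow n M) x y = \prod_(k < n) entry M (x k) (y k).
Proof. by rewrite entry_mkop. Qed.

Lemma tpow_mul T n (M N : op R T) : tpow n (M *m N) = tpow n M *m tpow n N.
Proof.
apply: opP => x y; rewrite entry_mul entry_tpow.
under eq_bigr do rewrite entry_mul.
rewrite bigA_distr_bigA /=; apply: eq_bigr => f _.
by rewrite !entry_tpow -big_split.
Qed.

Lemma tpow_adj T n (M : op R T) : tpow n (adj M) = adj (tpow n M).
Proof.
apply: opP => x y; rewrite entry_adj !entry_tpow rmorph_prod.
by apply: eq_bigr => k _; rewrite entry_adj.
Qed.

Lemma tpow_dg T n (d : T -> R) : tpow n (dgT d) = dgT (fun f : {ffun 'I_n -> T} => \prod_k d (f k)).
Proof.
apply: opP => x y; rewrite entry_dgT entry_tpow.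
rewrite (eq_bigr (fun k => (d (x k))%:c *+ (x k == y k))); last first.
  by move=> k _; rewrite entry_dgT.
case: (eqVneq x y) => [->|hxy].
  by rewrite mulr1n c_prod; apply: eq_bigr => k _; rewrite eqxx mulr1n.
have [k hk] : exists k, x k != y k.
  apply/existsP; apply: contraNT hxy; rewrite negb_exists => /forallP h.
  by apply/eqP/ffunP => k; apply/eqP; rewrite -[_ == _]negbK.
by rewrite mulr0n (bigD1 k) //= (negPf hk) mulr0n mul0r.
Qed.

Lemma dgT1 T : dgT (fun _ : T => 1) = 1%:M.
Proof. by rewrite /dgT -dg1. Qed.

Lemma tpow1 T n : tpow n (1%:M : op R T) = 1%:M.
Proof.
rewrite -dgT1 tpow_dg -dgT1; congr dgT; apply/funext => f; by rewrite big1.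
Qed.

Lemma spec_tpow T n (M U : op R T) d : specT M U d ->
  specT (tpow n M) (tpow n U) (fun f : {ffun 'I_n -> T} => \prod_k d (f k)).
Proof.
move=> [h1 h2]; split; first by rewrite -tpow_adj -tpow_mul h1 tpow1.
by rewrite h2 !tpow_mul tpow_adj -/(dgT d) tpow_dg.
Qed.

Lemma tr_tpow T n (M : op R T) : \tr (tpow n M) = (\tr M) ^+ n.
Proof.
rewrite !tr_entry -[in RHS](card_ord n) -prodr_const bigA_distr_bigA.
by apply: eq_bigr => f _; rewrite entry_tpow.
Qed.

Lemma psd_tpow T n (M : op R T) : psd M -> psd (tpow n M).
Proof.
move=> /psd_sqrt [K [K1 <- _]]; rewrite tpow_mul -{2}K1 tpow_adj.
exact: psd_mul_adj.
Qed.

Lemma density_tpow T n (M : op R T) : density M -> density (tpow n M).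
Proof. by case=> h1 h2; split; [exact: psd_tpow|rewrite tr_tpow h2 expr1n]. Qed.

Lemma perm_inv_tpow T n (M : op R T) : Defs.perm_inv (tpow n M).
Proof.
move=> s x y; rewrite !entry_tpow [RHS](reindex_inj (@perm_inj _ s)) /=.
by apply: eq_bigr => k _; rewrite !ffunE.
Qed.

Lemma entry_tens TA TB (X : op R TA) (Y : op R TB) x y :
  entry (tens X Y) x y = entry X x.1 y.1 * entry Y x.2 y.2.
Proof. by rewrite entry_mkop. Qed.

Lemma tens_mul TA TB (X X' : op R TA) (Y Y' : op R TB) :
  tens (X *m X') (Y *m Y') = tens X Y *m tens X' Y'.
Proof.
apply: opP => x y; rewrite entry_mul entry_tens !entry_mul big_distrlr /= pair_bigA /=.
by apply: eq_bigr => z _; rewrite !entry_tens mulrACA.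
Qed.

Lemma tens_adj TA TB (X : op R TA) (Y : op R TB) : tens (adj X) (adj Y) = adj (tens X Y).
Proof. by apply: opP => x y; rewrite entry_adj !entry_tens !entry_adj rmorphM. Qed.

Lemma tens_dg TA TB (d : TA -> R) (e : TB -> R) :
  tens (dgT d) (dgT e) = dgT (fun x : (TA * TB)%type => d x.1 * e x.2).
Proof.
apply: opP => -[a b] [a' b']; rewrite entry_tens !entry_dgT xpair_eqE /=.
by case: (a == a'); case: (b == b'); rewrite ?mulr1n ?mulr0n ?mulr0 ?mul0r ?cM.
Qed.

Lemma tens1 TA TB : tens (1%:M : op R TA) (1%:M : op R TB) = 1%:M.
Proof. by rewrite -!dgT1 tens_dg; congr dgT; apply/funext => x; rewrite mulr1. Qed.

Lemma spec_tens TA TB (M U : op R TA) (N W : op R TB) d e :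
  specT M U d -> specT N W e ->
  specT (tens M N) (tens U W) (fun x : (TA * TB)%type => d x.1 * e x.2).
Proof.
move=> [h1 h2] [h3 h4]; split; first by rewrite -tens_adj -tens_mul h1 h3 tens1.
by rewrite h2 h4 !tens_mul tens_adj -/(dgT d) -/(dgT e) tens_dg.
Qed.

Lemma psd_tens TA TB (X : op R TA) (Y : op R TB) : psd X -> psd Y -> psd (tens X Y).
Proof.
move=> /psd_sqrt [K [K1 <- _]] /psd_sqrt [L [L1 <- _]].
rewrite tens_mul -{2}K1 -{2}L1 tens_adj; exact: psd_mul_adj.
Qed.

(** * Products of operators on A^n and on B^n *)

Section TensN.
Variables (TA TB : finType) (n : nat).
Local Notation fA := {ffun 'I_n -> TA}.
Local Notation fB := {ffun 'I_n -> TB}.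

Lemma entry_tens_n (X : op R fA) (Y : op R fB) x y :
  entry (tens_n X Y) x y = entry X [ffun k => (x k).1] [ffun k => (y k).1] *
     entry Y [ffun k => (x k).2] [ffun k => (y k).2].
Proof. by rewrite entry_mkop. Qed.

Lemma tens_n_mul (X X' : op R fA) (Y Y' : op R fB) :
  tens_n (X *m X') (Y *m Y') = tens_n X Y *m tens_n X' Y'.
Proof.
apply: opP => x y; rewrite entry_mul entry_tens_n !entry_mul big_distrlr /=.
rewrite -(@sum_ffun_pair _ _ _ _ (fun f g => entry X _ f * entry X' f _ * (entry Y _ g * entry Y' g _))).
by apply: eq_bigr => z _; rewrite !entry_tens_n mulrACA.
Qed.

Lemma tens_n_adj (X : op R fA) (Y : op R fB) : tens_n (adj X) (adj Y) = adj (tens_n X Y).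
Proof. by apply: opP => x y; rewrite entry_adj !entry_tens_n !entry_adj rmorphM. Qed.

Lemma tens_n1 : tens_n (1%:M : op R fA) (1%:M : op R fB) = 1%:M.
Proof.
apply: opP => x y; rewrite entry_tens_n !entry1.
case: (eqVneq x y) => [->|hxy]; first by rewrite !eqxx mulr1.
case: eqP => e1; last by rewrite mul0r.
case: eqP => e2; last by rewrite mulr0.
case/eqP: hxy; apply/ffunP => k; move/ffunP/(_ k): e1; move/ffunP/(_ k): e2.
by rewrite !ffunE; case: (x k) (y k) => [a b] [a' b'] /= -> ->.
Qed.

Lemma tens_nBl (X X' : op R fA) (Y : op R fB) : tens_n (X - X') Y = tens_n X Y - tens_n X' Y.
Proof. by apply: opP => x y; rewrite entryB !entry_tens_n entryB mulrBl. Qed.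

Lemma tens_nBr (X : op R fA) (Y Y' : op R fB) : tens_n X (Y - Y') = tens_n X Y - tens_n X Y'.
Proof. by apply: opP => x y; rewrite entryB !entry_tens_n entryB mulrBr. Qed.

Lemma tens_nZ c d (X : op R fA) (Y : op R fB) :
  tens_n (c *: X) (d *: Y) = (c * d) *: tens_n X Y.
Proof. by apply: opP => x y; rewrite entryZ !entry_tens_n !entryZ mulrACA. Qed.

Lemma psd_tens_n (X : op R fA) (Y : op R fB) : psd X -> psd Y -> psd (tens_n X Y).
Proof.
move=> /psd_sqrt [K [K1 <- _]] /psd_sqrt [L [L1 <- _]].
rewrite tens_n_mul -{2}K1 -{2}L1 tens_n_adj; exact: psd_mul_adj.
Qed.

(** Telescoping: the difference is (X' - X) (x) Y' + X (x) (Y' - Y). *)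
Lemma tens_n_le (X X' : op R fA) (Y Y' : op R fB) : psd X -> psd Y' ->
  psd (X' - X) -> psd (Y' - Y) -> psd (tens_n X' Y' - tens_n X Y).
Proof.
move=> hX hY h1 h2; have := psdD (psd_tens_n h1 hY) (psd_tens_n hX h2).
by rewrite tens_nBl tens_nBr addrA subrK.
Qed.

Lemma tens_n_tpow (X : op R TA) (Y : op R TB) :
  tens_n (tpow n X) (tpow n Y) = tpow n (tens X Y).
Proof.
apply: opP => x y; rewrite entry_tens_n !entry_tpow -big_split /=.
by apply: eq_bigr => k _; rewrite entry_tens !ffunE.
Qed.

(** Dual form of the fact that the marginal of a power is the power of the marginal; it avoids a
    partial trace on n-fold labels. *)
Lemma tr_ptrB_n (rho : op R (TA * TB)%type) (X : op R fA) :
  \tr (tpow n rho *m tens_n X 1%:M) = \tr (tpow n (ptrB rho) *m X).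
Proof.
rewrite !tr_entry; under eq_bigr do rewrite entry_mul.
under [RHS]eq_bigr do rewrite entry_mul.
pose G (f : fA) (g : fB) (f' : fA) (g' : fB) : C :=
  (\prod_k entry rho (f k, g k) (f' k, g' k)) * (entry X f' f * (g' == g)%:R).
transitivity (\sum_f \sum_g \sum_f' \sum_g' G f g f' g').
  rewrite -(@sum_ffun_pair _ _ _ _ (fun f g => \sum_f' \sum_g' G f g f' g')).
  apply: eq_bigr => x _; rewrite -(@sum_ffun_pair _ _ _ _ (G _ _)).
  apply: eq_bigr => y _; rewrite /G entry_tpow entry_tens_n entry1; congr (_ * _).
  by apply: eq_bigr => k _; rewrite !ffunE -!surjective_pairing.
apply: eq_bigr => f _; rewrite exchange_big; apply: eq_bigr => f' _ /=.
rewrite entry_tpow; under [in RHS]eq_bigr do rewrite entry_mkop.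
rewrite bigA_distr_bigA mulr_suml; apply: eq_bigr => g _.
rewrite (bigD1 g) //= big1 ?addr0 => [|g' hg]; rewrite /G ?eqxx ?mulr1 //.
by rewrite (negPf hg) !mulr0.
Qed.

Lemma tr_ptrA_n (rho : op R (TA * TB)%type) (Y : op R fB) :
  \tr (tpow n rho *m tens_n 1%:M Y) = \tr (tpow n (ptrA rho) *m Y).
Proof.
rewrite !tr_entry; under eq_bigr do rewrite entry_mul.
under [RHS]eq_bigr do rewrite entry_mul.
pose G (f : fA) (g : fB) (f' : fA) (g' : fB) : C :=
  (\prod_k entry rho (f k, g k) (f' k, g' k)) * ((f' == f)%:R * entry Y g' g).
transitivity (\sum_f \sum_g \sum_f' \sum_g' G f g f' g').
  rewrite -(@sum_ffun_pair _ _ _ _ (fun f g => \sum_f' \sum_g' G f g f' g')).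
  apply: eq_bigr => x _; rewrite -(@sum_ffun_pair _ _ _ _ (G _ _)).
  apply: eq_bigr => y _; rewrite /G entry_tpow entry_tens_n entry1; congr (_ * _).
  by apply: eq_bigr => k _; rewrite !ffunE -!surjective_pairing.
rewrite exchange_big; apply: eq_bigr => g _ /=.
under eq_bigr do rewrite exchange_big /=.
rewrite exchange_big; apply: eq_bigr => g' _ /=.
rewrite entry_tpow; under [in RHS]eq_bigr do rewrite entry_mkop.
rewrite bigA_distr_bigA mulr_suml; apply: eq_bigr => f _.
rewrite (bigD1 f) //= big1 ?addr0 => [|f' hf]; rewrite /G ?eqxx ?mul1r //.
by rewrite (negPf hf) mul0r !mulr0.
Qed.
End TensN.

Lemma tr_ptrB TA TB (rho : op R (TA * TB)%type) (X : op R TA) :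
  \tr (rho *m tens X 1%:M) = \tr (ptrB rho *m X).
Proof.
rewrite !tr_entry; under eq_bigr do rewrite entry_mul.
under [RHS]eq_bigr do rewrite entry_mul.
rewrite sum_pair; apply: eq_bigr => a _.
under eq_bigr do rewrite sum_pair.
rewrite exchange_big; apply: eq_bigr => a' _ /=.
rewrite entry_mkop mulr_suml; apply: eq_bigr => b _.
rewrite (bigD1 b) //= big1 ?addr0 => [|b' hb]; rewrite entry_tens entry1 /= ?eqxx ?mulr1 //.
by rewrite (negPf hb) !mulr0.
Qed.

Lemma tr_ptrA TA TB (rho : op R (TA * TB)%type) (Y : op R TB) :
  \tr (rho *m tens 1%:M Y) = \tr (ptrA rho *m Y).
Proof.
rewrite !tr_entry; under eq_bigr do rewrite entry_mul.
under [RHS]eq_bigr do rewrite entry_mul.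
rewrite sum_pair.
rewrite exchange_big; apply: eq_bigr => b _ /=.
under eq_bigr do rewrite sum_pair exchange_big /=.
rewrite exchange_big; apply: eq_bigr => b' _ /=.
rewrite entry_mkop mulr_suml; apply: eq_bigr => a _.
rewrite (bigD1 a) //= big1 ?addr0 => [|a' ha]; rewrite entry_tens entry1 /= ?eqxx ?mul1r //.
by rewrite (negPf ha) mul0r !mulr0.
Qed.

(** Positivity by duality: a rank-one X pairs with the marginal as the positive operator X (x) 1
    pairs with [rho]. *)
Lemma density_ptrB TA TB (rho : op R (TA * TB)%type) : density rho -> density (ptrB rho).
Proof.
move=> [h1 h2]; split; last by have := tr_ptrB rho 1%:M; rewrite tens1 !mulmx1 => <-.
apply: tr_psd_psd => K; rewrite -tr_ptrB; apply: tr_psd_mulC => //.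
by apply: psd_tens; [exact: psd_mul_adj|exact: psd1].
Qed.

Lemma density_ptrA TA TB (rho : op R (TA * TB)%type) : density rho -> density (ptrA rho).
Proof.
move=> [h1 h2]; split; last by have := tr_ptrA rho 1%:M; rewrite tens1 !mulmx1 => <-.
apply: tr_psd_psd => K; rewrite -tr_ptrA; apply: tr_psd_mulC => //.
by apply: psd_tens; [exact: psd1|exact: psd_mul_adj].
Qed.

End Labels.

(** * A universal symmetric operator *)

Section Universal.
Variable R : realType.
Local Notation C := R[i].
Local Notation "x %:c" := (Complex x (0:R)) (at level 2, format "x %:c").

(** Cauchy-Schwarz with weights that may vanish. There the inverse weight is 0 by convention and the
    right side loses its term, so [b k = 0] is required to lose it on the left as well. *)
Lemma weighted_cs (I : finType) (w : I -> R) (a b : I -> C) :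
  (forall k, 0 <= w k) -> (forall k, w k = 0 -> b k = 0) ->
  \sum_k w k * nsq (a k) = 1 ->
  nsq (\sum_k a k * b k) <= \sum_k (w k)^-1 * nsq (b k).
Proof.
move=> hw hb h1; set z := \sum_k _.
(* Nonnegativity of |b - w conj(a) z|^2 / w. Summed over k, the left sides give 2 |z|^2 - |z|^2. *)
have hk k : 2 * re (Num.conj z * (a k * b k)) - nsq z * (w k * nsq (a k)) <= (w k)^-1 * nsq (b k).
  have := hw k; rewrite le_eqVlt => /orP[/eqP e|wp].
    rewrite (hb k (esym e)) -e !mulr0 mul0r mulr0 nsq0 mulr0 /re /=; lra.
  have -> : (w k)^-1 * nsq (b k) = 2 * re (Num.conj z * (a k * b k)) - nsq z * (w k * nsq (a k))
      + (w k)^-1 * nsq (b k - (w k)%:c * Num.conj (a k) * z).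
    case: z (a k) (b k) => [z1 z2] [a1 a2] [b1 b2].
    by rewrite /nsq /re /=; field; rewrite gt_eqF.
  by rewrite lerDl mulr_ge0 ?invr_ge0 ?nsq_ge0.
have : \sum_k (2 * re (Num.conj z * (a k * b k)) - nsq z * (w k * nsq (a k)))
  <= \sum_k (w k)^-1 * nsq (b k) by apply: ler_sum => k _.
have -> : \sum_k (2 * re (Num.conj z * (a k * b k)) - nsq z * (w k * nsq (a k))) = nsq z.
  rewrite sumrB -!mulr_sumr h1 mulr1 -re_sum -mulr_sumr -/z (mulrC (Num.conj z)) -nsqE.
  rewrite /re /=; ring.
by [].
Qed.

Variables (T : finType) (n : nat).
Local Notation L := {ffun 'I_n -> T}.
Local Notation opn := (op R L).

Definition pact (s : {perm 'I_n}) (x : L) : L := [ffun k => x (s k)].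

Lemma pactK s : cancel (pact s) (pact s^-1%g).
Proof. by move=> x; apply/ffunP => k; rewrite !ffunE permKV. Qed.
Lemma pactKV s : cancel (pact s^-1%g) (pact s).
Proof. by move=> x; apply/ffunP => k; rewrite !ffunE permK. Qed.

Definition pmat (s : {perm 'I_n}) : opn := mkop (fun x y => (y == pact s x)%:R).

Lemma entry_pmat_mul s (M : opn) x y : entry (pmat s *m M) x y = entry M (pact s x) y.
Proof.
rewrite entry_mul (bigD1 (pact s x)) //= big1 ?addr0 => [|z hz]; rewrite entry_mkop ?eqxx ?mul1r //.
by rewrite (negPf hz) mul0r.
Qed.

Lemma entry_mul_pmat s (M : opn) x y : entry (M *m pmat s) x y = entry M x (pact s^-1%g y).
Proof.
rewrite entry_mul (bigD1 (pact s^-1%g y)) //= big1 ?addr0 => [|z hz]; rewrite entry_mkop ?pactKV ?eqxx ?mulr1 //.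
case: (y =P pact s z) hz => [->|_ _]; first by rewrite pactK eqxx.
by rewrite mulr0.
Qed.

Lemma perm_inv_comm (M : opn) : Defs.perm_inv M <-> forall s, pmat s *m M = M *m pmat s.
Proof.
split=> h s.
  apply: opP => x y; rewrite entry_pmat_mul entry_mul_pmat -(h s x).
  by rewrite -/(pact s x) -/(pact s (pact _ y)) pactKV.
move=> x y; rewrite -/(pact s x) -/(pact s y) -entry_pmat_mul h entry_mul_pmat pactK //.
Qed.

Lemma perm_inv_mul (M N : opn) : Defs.perm_inv M -> Defs.perm_inv N -> Defs.perm_inv (M *m N).
Proof.
move=> /perm_inv_comm hM /perm_inv_comm hN; apply/perm_inv_comm => s.
by rewrite mulmxA hM -(mulmxA M) hN mulmxA.
Qed.

Definition ptup (x y : L) : n.-tuple (T * T)%type := [tuple (x k, y k) | k < n].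

(** The joint type: how often each pair of letters occurs. It is a complete invariant of
    simultaneous permutation of x and y, so the entries of a permutation-invariant operator depend
    on it alone, and there are only polynomially many types. *)
Definition ptype (x y : L) : {ffun (T * T)%type -> 'I_n.+1} :=
  [ffun ab => inord (count_mem ab (ptup x y))].

Lemma ptype_eq x y x' y' : ptype x y = ptype x' y' ->
  exists s, x' = pact s x /\ y' = pact s y.
Proof.
move=> h.
have /tuple_permP [s hs] : perm_eq (ptup x' y') (ptup x y).
  apply/allP => ab _ /=; apply/eqP.
  have hc z w : (count_mem ab (ptup z w) < n.+1)%N.
    by rewrite ltnS; apply: leq_trans (count_size _ _) _; rewrite size_tuple.
  have := congr1 (fun f : {ffun _ -> 'I_n.+1} => nat_of_ord (f ab)) h.
  by rewrite /ptype !ffunE !inordK ?hc.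
exists s.
have hk k : (x' k, y' k) = (x (s k), y (s k)).
  have : ptup x' y' = [tuple tnth (ptup x y) (s i) | i < n] by apply: val_inj.
  by move/(congr1 (fun t => tnth t k)); rewrite !tnth_mktuple.
by split; apply/ffunP => k; rewrite ffunE; case: (hk k).
Qed.

Lemma ptype_pact s x y : ptype (pact s x) (pact s y) = ptype x y.
Proof.
apply/ffunP => ab; rewrite !ffunE; congr inord.
have /seq.permP -> // : perm_eq (ptup (pact s x) (pact s y)) (ptup x y).
apply/tuple_permP; exists s; apply/esym; congr tval.
by apply: eq_from_tnth => k; rewrite !tnth_mktuple !ffunE.
Qed.

Lemma perm_inv_ptype (M : opn) x y x' y' : Defs.perm_inv M ->
  ptype x y = ptype x' y' -> entry M x y = entry M x' y'.
Proof. by move=> h /ptype_eq [s [-> ->]]; rewrite -(h s). Qed.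

Local Notation K := {ffun (T * T)%type -> 'I_n.+1}.

(** Indicator matrix of one orbit of pairs. [tmult k] is the size of the orbit, which is the squared
    Hilbert-Schmidt norm of [tbase k]; it is 0 for count functions that no pair realises. *)
Definition tbase (k : K) : opn := mkop (fun x y => (ptype x y == k)%:R).
Definition tmult (k : K) : R := \sum_x \sum_y (ptype x y == k)%:R.

Lemma tmult_ge0 k : 0 <= tmult k.
Proof. by do 2![apply: sumr_ge0 => ? _]. Qed.

Lemma tmult_eq0 k : tmult k = 0 -> tbase k = 0.
Proof.
move=> h; apply: opP => x y; rewrite entry_mkop entry0.
have /eqP := h; rewrite psumr_eq0; last by move=> ? _; apply: sumr_ge0.
move=> /allP/(_ x); rewrite mem_index_enum => /(_ isT)/=.
rewrite psumr_eq0 // => /allP/(_ y); rewrite mem_index_enum => /(_ isT)/= /eqP.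
by case: (_ == _) => // /eqP; rewrite oner_eq0.
Qed.

Lemma perm_inv_tbase k : Defs.perm_inv (tbase k).
Proof. by move=> s x y; rewrite !entry_mkop -/(pact s x) -/(pact s y) ptype_pact. Qed.

Definition tcoef (M : opn) (k : K) : C :=
  if [pick p : (L * L)%type | ptype p.1 p.2 == k] is Some p then entry M p.1 p.2 else 0.

Lemma tcoefE (M : opn) x y : Defs.perm_inv M -> tcoef M (ptype x y) = entry M x y.
Proof.
move=> h; rewrite /tcoef; case: pickP => [p /eqP hp|/(_ (x, y))]; last by rewrite eqxx.
exact: perm_inv_ptype.
Qed.

Lemma tcoef_expand (M : opn) : Defs.perm_inv M -> M = \sum_k tcoef M k *: tbase k.
Proof.
move=> h; apply: opP => x y; rewrite entry_sum (bigD1 (ptype x y)) //= big1 ?addr0 => [|k hk].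
  by rewrite entryZ entry_mkop eqxx mulr1 tcoefE.
by rewrite entryZ entry_mkop eq_sym (negPf hk) mulr0.
Qed.

Lemma natr_c (b : bool) : (b%:R : C) = (b%:R : R)%:c.
Proof. by case: b. Qed.

Lemma tcoef_tr (M : opn) k : Defs.perm_inv M ->
  \tr (adj (tbase k) *m M) = tcoef M k * (tmult k)%:c.
Proof.
move=> h; rewrite mxtrace_mulC tr_entry /tmult c_sum mulr_sumr; apply: eq_bigr => x _.
rewrite entry_mul c_sum mulr_sumr; apply: eq_bigr => y _.
rewrite entry_adj entry_mkop -natr_c conjC_nat.
by case: eqP => [<-|_]; rewrite ?mulr0 // tcoefE.
Qed.

Lemma tbase_expand (M : opn) : Defs.perm_inv M ->
  M = \sum_k ((tmult k)^-1%:c * \tr (adj (tbase k) *m M)) *: tbase k.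
Proof.
move=> h; rewrite {1}(tcoef_expand h); apply: eq_bigr => k _; rewrite tcoef_tr //.
have [e|e] := eqVneq (tmult k) 0; first by rewrite (tmult_eq0 e) !scaler0.
by rewrite mulrCA -cM mulVf // mulr1.
Qed.

(* Sum of [E *m adj E] over the orthonormal basis [tbase k / sqrt (tmult k)] of
   the algebra of permutation-invariant operators. *)
Definition universal : opn := \sum_k (tmult k)^-1%:c *: (tbase k *m adj (tbase k)).

Lemma universal_psd : psd universal.
Proof.
apply: psd_sum => k _; apply: psdZ; first by rewrite invr_ge0 tmult_ge0.
exact: psd_mul_adj.
Qed.

(** Left multiplication by a hermitian H is self-adjoint for the Hilbert-Schmidt product on the
    invariant algebra, so its matrix [t] is hermitian. This makes H times [universal] hermitian, and
    a product of two hermitian matrices is hermitian only if they commute. *)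
Lemma universal_comm (H : opn) : adj H = H -> Defs.perm_inv H ->
  universal *m H = H *m universal.
Proof.
move=> h1 h2; have hO : adj universal = universal by apply: psd_herm; apply: universal_psd.
suff hh : adj (H *m universal) = H *m universal by rewrite -hh adjM h1 hO.
pose t k l := \tr (adj (tbase l) *m (H *m tbase k)).
have e : H *m universal = \sum_k \sum_l ((tmult k)^-1%:c * (tmult l)^-1%:c * t k l) *:
    (tbase l *m adj (tbase k)).
  rewrite /universal mulmx_sumr; apply: eq_bigr => k _.
  rewrite -scalemxAr mulmxA {1}(tbase_expand (perm_inv_mul h2 (perm_inv_tbase k))).
  rewrite mulmx_suml scaler_sumr; apply: eq_bigr => l _.
  by rewrite -scalemxAl scalerA mulrA.
rewrite e adj_sum exchange_big /=; apply: eq_bigr => k _; rewrite adj_sum.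
apply: eq_bigr => l _; rewrite adjCZ adjM adjK !rmorphM /= !conj_c; congr (_ * _ *: _).
  exact: mulrC.
by rewrite /t -mxtrace_adj !adjM adjK h1 mulmxA.
Qed.

(** Each normalised basis element contributes its squared norm 1, and each unrealised type 0. *)
Lemma tr_universal : re (\tr universal) <= (n.+1 ^ #|{: T * T}|)%:R.
Proof.
have -> : re (\tr universal) = \sum_k (tmult k)^-1 * tmult k.
  rewrite /universal raddf_sum re_sum; apply: eq_bigr => k _ /=.
  rewrite mxtraceZ reZ; congr (_ * _).
  rewrite tr_entry re_sum /tmult; apply: eq_bigr => x _.
  rewrite entry_mul re_sum; apply: eq_bigr => y _.
  rewrite entry_adj !entry_mkop conjC_nat; case: (_ == _); by rewrite ?mul0r ?mulr1.
apply: (@le_trans _ _ (\sum_(k : K) 1)); last first.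
  by rewrite sumr_const card_ffun card_ord.
apply: ler_sum => k _; have [->|e] := eqVneq (tmult k) 0; first by rewrite mulr0.
by rewrite mulVf.
Qed.

(** The square root Q of S commutes with all permutations because S does, so it expands in the
    basis, with coefficients of total weight tr (Q^2) = tr S = 1. Then v S v^dagger = |v Q|^2, and
    [weighted_cs] applies in each coordinate. *)
Lemma universal_dominates (S : opn) : sym_density S -> psd (universal - S).
Proof.
move=> [[hS tS] /perm_inv_comm pS].
have [Q [Q1 Q2 Q3]] := psd_sqrt hS.
have pQ : Defs.perm_inv Q by apply/perm_inv_comm => s; rewrite Q3.
have hc : \sum_k tmult k * nsq (tcoef Q k) = 1.
  have := congr1 (@re R) tS; rewrite -Q2 -{2}Q1 tr_entry re_sum => h.
  rewrite -[1 in RHS]/(re 1) -h /tmult.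
  under eq_bigr do rewrite mulr_suml; rewrite exchange_big; apply: eq_bigr => x _ /=.
  rewrite entry_mul re_sum; under eq_bigr do rewrite mulr_suml; rewrite exchange_big.
  apply: eq_bigr => y _ /=; rewrite entry_adj -nsqE /re /=.
  rewrite (bigD1 (ptype x y)) //= big1 ?addr0 => [|k hk].
    by rewrite eqxx mul1r tcoefE.
  by rewrite eq_sym (negPf hk) mul0r.
have hv (v : 'rV[C]_#|L|) : nrm2 (v *m Q) <= \sum_k (tmult k)^-1 * nrm2 (v *m tbase k).
  under eq_bigr do rewrite mulr_sumr; rewrite exchange_big; apply: ler_sum => j _ /=.
  have -> : (v *m Q) 0 j = \sum_k tcoef Q k * (v *m tbase k) 0 j.
    rewrite {1}(tcoef_expand pQ) mulmx_sumr summxE; apply: eq_bigr => k _.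
    by rewrite -scalemxAr mxZE.
  apply: weighted_cs hc; first exact: tmult_ge0.
  by move=> k /tmult_eq0 ->; rewrite mulmx0 mxE.
apply: psd_nrm2 => v.
have -> : v *m (universal - S) *m adj v =
   (\sum_k (tmult k)^-1 * nrm2 (v *m tbase k) - nrm2 (v *m Q))%:c%:M.
  rewrite mulmxBr mulmxBl cD cN raddfB /=; congr (_ - _); last first.
    by rewrite -nrm2E -Q2 adjM Q1 !mulmxA.
  rewrite /universal mulmx_sumr mulmx_suml c_sum raddf_sum; apply: eq_bigr => k _ /=.
  rewrite -scalemxAr -scalemxAl cM scalar_mxM mul_scalar_mx; congr (_ *: _).
  by rewrite -nrm2E adjM !mulmxA.
by rewrite mxE eqxx mulr1n; apply: c_ge0; rewrite subr_ge0.
Qed.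

Lemma universal_cut (rho : op R T) (c : R) : 0 <= c -> density rho ->
  exists P : opn, [/\ adj P = P, P *m P = P,
    (forall S, sym_density S -> psd (c%:c *: tpow n rho - P *m S *m P)) &
    c * re (\tr (tpow n rho *m (1%:M - P))) <= (n.+1 ^ #|{: T * T}|)%:R].
Proof.
move=> hc hr; have [h1 _] := density_tpow n hr.
have hcomm := universal_comm (psd_herm h1) (perm_inv_tpow rho).
have [P [P1 P2 P3 P4]] := spectral_cut universal_psd h1 hcomm hc.
exists P; split; [exact: P1|exact: P2| |exact: le_trans P4 tr_universal].
move=> S hS; apply: psd_trans P3.
have := psd_conj P (universal_dominates hS); rewrite P1 mulmxBr mulmxBl; exact.
Qed.

End Universal.

(** * Moderate deviations of a finite random variable *)

Section ModerateDeviations.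
Variable R : realType.

Lemma expR_ge1 (x : R) : 0 <= x -> 1 <= expR x.
Proof. by move=> hx; apply: le_trans (expR_ge1Dx x); rewrite lerDl. Qed.

(** Raises the order of a Taylor remainder by one; it is applied twice to the exponential below,
    with constants left crude. *)
Lemma mvt_at0 (f df : R -> R) (y B : R) :
  (forall x : R, is_derive x 1 f (df x)) -> f 0 = 0 ->
  (forall c, `|c| <= `|y| -> `|df c| <= B) -> `|f y| <= B * `|y|.
Proof.
move=> hd h0 hB.
have hc a b : {within `[a, b], continuous f}.
  apply: derivable_within_continuous => x _; have [h _] := hd x; exact: h.
have [hy|hy] := leP 0 y.
  have [c hcy] := MVT_segment hy (fun x _ => hd x) (hc _ _).
  rewrite h0 !subr0 => ->; rewrite normrM ler_wpM2r // hB //.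
  by move: hcy; rewrite in_itv /= => /andP[c0 cy]; rewrite !ger0_norm.
have [c hcy] := MVT_segment (ltW hy) (fun x _ => hd x) (hc _ _).
rewrite h0 !sub0r => /eqP; rewrite eqr_oppLR => /eqP ->; rewrite normrN normrM normrN ler_wpM2r // hB //.
move: hcy; rewrite in_itv /= => /andP[c0 cy]; rewrite !ler0_norm ?lerN2 //; exact: ltW.
Qed.

Lemma expR_bound1 (c : R) : `|c| <= 1 / 2 -> `|expR c - 1| <= 2 * `|c|.
Proof.
rewrite ler_norml => /andP[h1 h2].
have e1 := expR_ge1Dx c; have e2 := expR_ge1Dx (- c).
have e3 : expR c * expR (- c) = 1 by rewrite -expRD subrr expR0.
have e4 := expR_gt0 c; have e5 := expR_gt0 (-c).
have [hc|hc] := leP 0 c.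
  rewrite !ger0_norm //; last by lra.
  have := ler_wpM2l (ltW e4) e2; rewrite e3.
  nra.
rewrite (ltr0_norm hc) ler_norml; apply/andP; split; first lra.
suff: expR c <= 1 by lra.
by rewrite expR_le1 ltW.
Qed.

Lemma expR_bound2 (c : R) : `|c| <= 1 / 2 -> `|expR c - 1 - c| <= 2 * `|c| * `|c|.
Proof.
move=> hc; apply: (@mvt_at0 (fun y => expR y - 1 - y) (fun y => expR y - 1)) => [x||d hd].
- apply: is_derive_eq; rewrite subr0 //.
- by rewrite expR0; lra.
- by apply: le_trans (expR_bound1 _) _; [exact: le_trans hd hc|rewrite ler_pM2l].
Qed.

Lemma expR_bound3 (c : R) : `|c| <= 1 / 2 ->
  `|expR c - 1 - c - c ^+ 2 / 2| <= 2 * `|c| ^+ 3.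
Proof.
move=> hc; have -> : 2 * `|c| ^+ 3 = 2 * `|c| * `|c| * `|c| by ring.
apply: (@mvt_at0 (fun y => expR y - 1 - y - y ^+ 2 / 2) (fun y => expR y - 1 - y)) => [x||d hd].
- apply: is_derive_eq; rewrite /GRing.scale /=; by field.
- by rewrite expR0; lra.
- apply: le_trans (expR_bound2 _) _; first exact: le_trans hd hc.
  by rewrite ler_pM // ?ler_pM2l // mulr_ge0.
Qed.

Variable X : finType.
Variables (P Z : X -> R) (v K : R).
Hypotheses (P0 : forall x, 0 <= P x) (P1 : \sum_x P x = 1).
Hypotheses (Zmean : \sum_x P x * Z x = 0) (Zvar : \sum_x P x * Z x ^+ 2 = v).
Hypotheses (v0 : 0 < v) (K0 : 0 < K) (ZK : forall x, `|Z x| <= K).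

(** The sign makes positive t tilt towards the lower tail, where the log-likelihood ratio falls
    below its mean. *)
Definition mgf (t : R) := \sum_x P x * expR (- t * Z x).

Lemma mgf_taylor t : `|t| * K <= 1 / 2 ->
  `|mgf t - 1 - t ^+ 2 * v / 2| <= 2 * (`|t| * K) ^+ 3.
Proof.
move=> ht.
have hb x : `|- t * Z x| <= `|t| * K by rewrite normrM normrN ler_wpM2l.
have -> : mgf t - 1 - t ^+ 2 * v / 2 =
    \sum_x P x * (expR (- t * Z x) - 1 - (- t * Z x) - (- t * Z x) ^+ 2 / 2).
  transitivity (\sum_x (P x * expR (- t * Z x) - P x + t * (P x * Z x) - t ^+ 2 / 2 * (P x * Z x ^+ 2))).
    rewrite sumrB big_split sumrB /= -!mulr_sumr P1 Zmean Zvar /mgf mulr0 addr0; by field.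
  by apply: eq_bigr => x _; field.
apply: le_trans (ler_norm_sum _ _ _) _.
have -> : 2 * (`|t| * K) ^+ 3 = \sum_x P x * (2 * (`|t| * K) ^+ 3) by rewrite -mulr_suml P1 mul1r.
apply: ler_sum => x _.
rewrite normrM (ger0_norm (P0 x)) ler_wpM2l //.
apply: le_trans (expR_bound3 (le_trans (hb x) ht)) _.
by rewrite ler_pM2l // lerXn2r // nnegrE mulr_ge0 // ltW.
Qed.

Lemma mgf_bounds (k : R) : 0 < k -> k < 1 -> exists2 t0 : R, 0 < t0 &
  forall t, `|t| <= t0 ->
    expR ((1 - k) * (t ^+ 2 * v / 2)) <= mgf t <= expR ((1 + k) * (t ^+ 2 * v / 2)).
Proof.
move=> k0 k1.
(* In order: t^2 <= |t|; validity of the Taylor bound; a cubic remainder of at most k / 2 times the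
   quadratic term w = t^2 v / 2; and w <= k / 4. *)
pose t0 : R := Num.min (Num.min 1 (1 / (2 * K))) (Num.min (k * v / (8 * K ^+ 3)) (k / (2 * v))).
have K3 : 0 < K ^+ 3 by rewrite exprn_gt0.
exists t0; first by rewrite /t0 !lt_min ltr01 !divr_gt0 // !mulr_gt0.
move=> t; rewrite /t0 !le_min => /andP[/andP[h1 h2] /andP[h3 h4]].
have a0 : 0 <= `|t| by [].
have g2 : `|t| * K <= 1 / 2.
  have := ler_wpM2r (ltW K0) h2; rewrite (_ : 1 / (2 * K) * K = 1 / 2) //.
  by field; rewrite gt_eqF.
have g3 : 2 * (`|t| * K) ^+ 3 <= t ^+ 2 * v / 2 * (k / 2).
  have := ler_wpM2l (sqr_ge0 t) (ler_wpM2r (ltW K3) h3).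
  have -> : k * v / (8 * K ^+ 3) * K ^+ 3 = k * v / 8 by field; rewrite gt_eqF.
  rewrite -[in X in X -> _](real_normK (num_real t)) => h.
  rewrite -(real_normK (num_real t)).
  have -> : 2 * (`|t| * K) ^+ 3 = 2 * (`|t| ^+ 2 * (`|t| * K ^+ 3)) by ring.
  lra.
have g4 : t ^+ 2 * v / 2 <= k / 4.
  have h := ler_wpM2r (ltW v0) h4; rewrite (_ : k / (2 * v) * v = k / 2) in h; last first.
    by field; rewrite gt_eqF.
  have : t ^+ 2 <= `|t| by rewrite -(real_normK (num_real t)) expr2 ler_piMl.
  move=> /(ler_wpM2r (ltW v0)); lra.
have := mgf_taylor g2; rewrite ler_norml => /andP[m1 m2].
set w := t ^+ 2 * v / 2 in g3 g4 m1 m2 *.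
have w0 : 0 <= w by rewrite /w; apply: mulr_ge0 => //; apply: mulr_ge0 (sqr_ge0 _) (ltW v0).
apply/andP; split; last first.
  apply: le_trans (expR_ge1Dx _); nra.
set u := (1 - k) * w.
have u0 : 0 <= u by rewrite /u mulr_ge0 // subr_ge0 ltW.
have uw : u <= w by rewrite /u; nra.
have e2 := expR_ge1Dx (- u).
have e3 : expR u * expR (- u) = 1 by rewrite -expRD subrr expR0.
have e4 := expR_gt0 u.
have := ler_wpM2l (ltW e4) e2; rewrite e3 => e5.
(* From (1 - u) e^u <= 1, since (1 + u + 2 u^2) (1 - u) = 1 + u^2 - 2 u^3 is at least 1 for 0 <= u
   <= 1 / 2. *)
have e6 : expR u <= 1 + u + 2 * u ^+ 2.
  have : 1 <= (1 + u + 2 * u ^+ 2) * (1 - u) by nra.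
  move=> h; have : expR u * (1 - u) <= (1 + u + 2 * u ^+ 2) * (1 - u) by lra.
  rewrite ler_pM2r //; lra.
have : u ^+ 2 <= w * (k / 4).
  by rewrite expr2; apply: (le_trans (ler_wpM2l u0 uw)); nra.
rewrite /u in e6 *; nra.
Qed.

Definition iid n (f : {ffun 'I_n -> X}) : R := \prod_k P (f k).
Definition tot n (f : {ffun 'I_n -> X}) : R := \sum_k Z (f k).

Lemma iid_ge0 n (f : {ffun 'I_n -> X}) : 0 <= iid f.
Proof. exact: prodr_ge0. Qed.

Lemma iid_mgf n t : \sum_(f : {ffun 'I_n -> X}) iid f * expR (- t * tot f) = mgf t ^+ n.
Proof.
rewrite -[in RHS](card_ord n) -prodr_const /mgf bigA_distr_bigA.
apply: eq_bigr => f _; rewrite /tot mulr_sumr expR_sum /iid -big_split //.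
Qed.

(** Chernoff bound at t = b / v, the minimiser of the quadratic approximation t^2 v / 2 - t b, whose
    minimum is - b^2 / (2 v). *)
Lemma moderate_deviation_upper (e : R) : 0 < e -> e < 1 -> exists2 b0 : R, 0 < b0 &
  forall b n, 0 < b -> b <= b0 ->
   \sum_(f : {ffun 'I_n -> X} | tot f <= - (n%:R * b)) iid f
     <= expR (- (n%:R * b ^+ 2 * (1 - e) / (2 * v))).
Proof.
move=> e0 e1; have [t0 t00 ht] := mgf_bounds e0 e1.
exists (t0 * v); first exact: mulr_gt0.
move=> b n b0 hb; pose t := b / v.
have tp : 0 < t by rewrite divr_gt0.
have /ht /andP[_ hm] : `|t| <= t0 by rewrite gtr0_norm // ler_pdivrMr.
apply: (@le_trans _ _ (expR (- t * (n%:R * b)) * mgf t ^+ n)).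
  rewrite -iid_mgf mulr_sumr big_mkcond /=; apply: ler_sum => f _.
  rewrite mulrCA -expRD; case: ifP => hf.
    rewrite ler_peMr ?iid_ge0 // expR_ge1 // -mulrDr mulNr oppr_ge0.
    apply: mulr_ge0_le0 (ltW tp) _; lra.
  by rewrite mulr_ge0 ?iid_ge0 ?expR_ge0.
apply: (@le_trans _ _ (expR (- t * (n%:R * b)) * expR ((1 + e) * (t ^+ 2 * v / 2)) ^+ n)).
  rewrite ler_pM2l ?expR_gt0 //; apply: lerXn2r => //; rewrite nnegrE ?expR_ge0 //.
  by apply: sumr_ge0 => x _; rewrite mulr_ge0 ?expR_ge0.
rewrite -expRM_natl -expRD ler_expR le_eqVlt; apply/orP; left; apply/eqP.
by rewrite /t; field; rewrite gt_eqF.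
Qed.

(* After tilting by [t], the two subtracted exponentials bound the probability
   of leaving the window [-B <= S <= -A]. *)
Lemma tail_indicator (S t s A B : R) : 0 < t -> 0 < s ->
  (1 - expR (s * (S + A)) - expR (- s * (S + B))) * expR (- t * (S + B))
   <= (if S <= - A then 1 else 0).
Proof.
move=> t0 s0.
have p1 := expR_gt0 (s * (S + A)); have p2 := expR_gt0 (- s * (S + B)).
have p3 := expR_gt0 (- t * (S + B)).
have [hA|hA] := leP S (- A); last first.
  have : 1 <= expR (s * (S + A)) by apply/expR_ge1/mulr_ge0; [exact: ltW|lra].
  by move=> h; apply: mulr_le0_ge0; [lra|exact: ltW].
have [hB|hB] := leP (- B) S.
  have : expR (- t * (S + B)) <= 1.
    by rewrite expR_le1 mulNr oppr_le0; apply: mulr_ge0; [exact: ltW|lra].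
  nra.
have : 1 <= expR (- s * (S + B)).
  by apply: expR_ge1; rewrite mulNr oppr_ge0; apply: mulr_ge0_le0; [exact: ltW|lra].
by move=> h; apply: (@le_trans _ _ 0) => //; apply: mulr_le0_ge0; [lra|exact: ltW].
Qed.

(** The expectation of [tail_indicator]: multiplying the tilt by the two penalties shifts t to t - s
    and t + s, so everything is again a generating function and no tilted measure needs to be
    introduced. *)
Lemma tail_lower n t s A B : 0 < t -> 0 < s ->
  expR (- t * B) * (mgf t ^+ n - expR (s * A) * mgf (t - s) ^+ n
     - expR (- s * B) * mgf (t + s) ^+ n)
  <= \sum_(f : {ffun 'I_n -> X} | tot f <= - A) iid f.
Proof.
move=> t0 s0; rewrite -!iid_mgf !mulr_sumr -!sumrB mulr_sumr [leRHS]big_mkcond /=.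
apply: ler_sum => f _; have := ler_wpM2l (iid_ge0 f) (tail_indicator (tot f) A B t0 s0).
have -> : iid f * (if tot f <= - A then 1 else 0) = if tot f <= - A then iid f else 0.
  by case: ifP => _; rewrite ?mulr1 ?mulr0.
apply: le_trans; rewrite le_eqVlt; apply/orP; left; apply/eqP.
rewrite !mulrDr !expRD.
have -> : - (t - s) * tot f = - t * tot f + s * tot f by ring.
have -> : - (t + s) * tot f = - t * tot f + - s * tot f by ring.
rewrite !expRD; ring.
Qed.

Lemma expR_le_half (x : R) : 1 <= x -> expR (- x) <= 1 / 2.
Proof.
move=> hx; have h : 2 <= expR x by apply: le_trans (expR_ge1Dx x); lra.
have : expR x * expR (- x) = 1 by rewrite -expRD subrr expR0.
have := expR_gt0 (- x); nra.
Qed.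

(** The tilt t = (1 + 2 h) b / v moves the mean near - n (1 + 2 h) b, the centre of the window from
    - n (1 + 4 h) b to - n b. Leaving it on either side is a deviation by 2 h n b, and s = 2 h b / v
    is the matching Chernoff parameter. *)
Lemma moderate_deviation_lower (e : R) : 0 < e -> e < 1 -> exists2 b0 : R, 0 < b0 &
  exists N0 : R, forall b n, 0 < b -> b <= b0 -> N0 <= n%:R * b ^+ 2 ->
   expR (- (n%:R * b ^+ 2 * (1 + e) / (2 * v))) <=
   \sum_(f : {ffun 'I_n -> X} | tot f <= - (n%:R * b)) iid f.
Proof.
(* In units of u = n b^2 / v, a side of the window is left with exponent about 2 h^2; k = h^2 / 4
   keeps the errors of [mgf_bounds] small enough for h^2 to remain. The factor e = 16 h leaves room
   for the width of the window and a prefactor. *)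
move=> e0 e1; pose h := e / 16; pose k := h ^+ 2 / 4.
have h0 : 0 < h by rewrite divr_gt0.
have h1 : h <= 1 / 16 by rewrite /h; lra.
have k0 : 0 < k by rewrite divr_gt0 // exprn_gt0.
have k1 : k < 1 by rewrite /k; nra.
have [t0 t00 ht] := mgf_bounds k0 k1.
exists (t0 * v / 2); first by rewrite divr_gt0 ?mulr_gt0.
(* Gives u h^2 >= 2, so each side of the window loses at most a quarter and half of the tilted mass
   remains. *)
exists (2 * v / h ^+ 2) => b n b0 hb hn.
pose u := n%:R * b ^+ 2 / v.
pose t := (1 + 2 * h) * (b / v); pose s := 2 * h * (b / v).
have bv : 0 < b / v by rewrite divr_gt0.
have tp : 0 < t by rewrite mulr_gt0 //; lra.
have sp : 0 < s by rewrite mulr_gt0 //; lra.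
have hbv : b / v <= t0 / 2 by rewrite ler_pdivrMr //; lra.
have hu : 2 <= u * h ^+ 2.
  have h2 : 0 < h ^+ 2 by rewrite exprn_gt0.
  have -> : u * h ^+ 2 = n%:R * b ^+ 2 * h ^+ 2 / v by rewrite /u mulrAC.
  by rewrite ler_pdivlMr // -ler_pdivrMr.
have u0 : 0 < u by nra.
apply: le_trans (tail_lower n (n%:R * b) (n%:R * ((1 + 4 * h) * b)) tp sp).
have M1 : expR (u * ((1 - k) * (1 + 2 * h) ^+ 2 / 2)) <= mgf t ^+ n.
  have /ht /andP[hm _] : `|t| <= t0 by rewrite gtr0_norm // /t; nra.
  have := lerXn2r n _ _ hm; rewrite !nnegrE expR_ge0 => /(_ isT).
  rewrite (le_trans _ hm) ?expR_ge0 // => /(_ isT); apply: le_trans.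
  rewrite -expRM_natl ler_expR le_eqVlt; apply/orP; left; apply/eqP.
  by rewrite /u /t; field; rewrite gt_eqF.
have mge0 x : 0 <= mgf x by apply: sumr_ge0 => y _; rewrite mulr_ge0 ?expR_ge0.
have M2 : mgf (t - s) ^+ n <= expR (u * ((1 + k) / 2)).
  have ets : t - s = b / v by rewrite /t /s; ring.
  have /ht /andP[_ hm] : `|t - s| <= t0 by rewrite ets gtr0_norm //; lra.
  have := lerXn2r n _ _ hm; rewrite !nnegrE expR_ge0 mge0 => /(_ isT isT) hh.
  apply: le_trans hh _.
  rewrite -expRM_natl ler_expR le_eqVlt; apply/orP; left; apply/eqP.
  by rewrite ets /u; field; rewrite gt_eqF.
have M3 : mgf (t + s) ^+ n <= expR (u * ((1 + k) * (1 + 4 * h) ^+ 2 / 2)).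
  have ets : t + s = (1 + 4 * h) * (b / v) by rewrite /t /s; ring.
  have /ht /andP[_ hm] : `|t + s| <= t0 by rewrite gtr0_norm ?ets //; nra.
  have := lerXn2r n _ _ hm; rewrite !nnegrE expR_ge0 mge0 => /(_ isT isT) hh.
  apply: le_trans hh _.
  rewrite -expRM_natl ler_expR le_eqVlt; apply/orP; left; apply/eqP.
  by rewrite ets /u; field; rewrite gt_eqF.
have kE : h ^+ 2 = 4 * k by rewrite /k; field.
have kh0 : 0 <= k * h by rewrite mulr_ge0 ?ltW.
have kh : k * h <= k / 16 by have := ler_wpM2l (ltW k0) h1; lra.
have khh : k * h ^+ 2 <= k / 16 by have := ler_wpM2l kh0 h1; lra.
have hh16 : h ^+ 2 <= h / 16 by have := ler_wpM2l (ltW h0) h1; lra.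
set a := u * ((1 - k) * (1 + 2 * h) ^+ 2 / 2) in M1.
have hq : expR (- (u * h ^+ 2)) <= 1 / 4.
  have -> : - (u * h ^+ 2) = - (u * h ^+ 2 / 2) + - (u * h ^+ 2 / 2) by field.
  rewrite expRD; have := @expR_le_half (u * h ^+ 2 / 2) _ => /(_ ltac:(lra)).
  have := expR_gt0 (- (u * h ^+ 2 / 2)); nra.
have L2 : expR (s * (n%:R * b)) * mgf (t - s) ^+ n <= expR a * (1 / 4).
  apply: (@le_trans _ _ (expR a * expR (- (u * h ^+ 2)))); last by rewrite ler_pM2l ?expR_gt0.
  apply: le_trans (ler_wpM2l (expR_ge0 _) M2) _.
  rewrite -!expRD ler_expR.
  have -> : s * (n%:R * b) = u * (2 * h) by rewrite /s /u; field; rewrite gt_eqF.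
  have q : 2 * h + (1 + k) / 2 <= (1 - k) * (1 + 2 * h) ^+ 2 / 2 - h ^+ 2 by lra.
  have := ler_wpM2l (ltW u0) q; rewrite /a; lra.
have L3 : expR (- s * (n%:R * ((1 + 4 * h) * b))) * mgf (t + s) ^+ n <= expR a * (1 / 4).
  apply: (@le_trans _ _ (expR a * expR (- (u * h ^+ 2)))); last by rewrite ler_pM2l ?expR_gt0.
  apply: le_trans (ler_wpM2l (expR_ge0 _) M3) _.
  rewrite -!expRD ler_expR.
  have -> : - s * (n%:R * ((1 + 4 * h) * b)) = u * (- (2 * h * (1 + 4 * h))).
    by rewrite /s /u; field; rewrite gt_eqF.
  have q : - (2 * h * (1 + 4 * h)) + (1 + k) * (1 + 4 * h) ^+ 2 / 2 <=
      (1 - k) * (1 + 2 * h) ^+ 2 / 2 - h ^+ 2 by lra.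
  have := ler_wpM2l (ltW u0) q; rewrite /a; lra.
apply: (@le_trans _ _ (expR (- t * (n%:R * ((1 + 4 * h) * b))) * (expR a * (1 / 2)))); last first.
  rewrite ler_pM2l ?expR_gt0 //; lra.
(* The remaining factor 1 / 2 is absorbed as e^(- u h). *)
have uh : 1 <= u * h by nra.
apply: (@le_trans _ _ (expR (- t * (n%:R * ((1 + 4 * h) * b))) * (expR a * expR (- (u * h))))); last first.
  by rewrite !ler_pM2l ?expR_gt0 // expR_le_half.
rewrite -!expRD ler_expR.
have -> : - t * (n%:R * ((1 + 4 * h) * b)) = u * (- ((1 + 2 * h) * (1 + 4 * h))).
  by rewrite /t /u; field; rewrite gt_eqF.
have -> : n%:R * b ^+ 2 * (1 + e) / (2 * v) = u * ((1 + 16 * h) / 2).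
  by rewrite /u /h; field; rewrite gt_eqF.
have q : - ((1 + 16 * h) / 2) <=
    - ((1 + 2 * h) * (1 + 4 * h)) + ((1 - k) * (1 + 2 * h) ^+ 2 / 2 - h) by lra.
have := ler_wpM2l (ltW u0) q; rewrite /a; lra.
Qed.

End ModerateDeviations.

(** * The Nussbaum-Szkola distribution of a state and its marginals *)

Section NussbaumSzkola.
Variable R : realType.
Local Notation C := R[i].
Local Notation "x %:c" := (Complex x (0:R)) (at level 2, format "x %:c").

Lemma unitary_row T (U : op R T) x : U *m adj U = 1%:M -> \sum_y nsq (entry U x y) = 1.
Proof.
move=> /matrixP/(_ (enum_rank x) (enum_rank x)).
have -> : (U *m adj U) (enum_rank x) (enum_rank x) = (\sum_y nsq (entry U x y))%:c.
  rewrite -/(entry (U *m adj U) x x) entry_mul c_sum; apply: eq_bigr => y _.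
  by rewrite entry_adj nsqE.
by rewrite mxE eqxx => -[].
Qed.

Lemma tr_fun_basis T (M U W : op R T) r h : specT M U r -> W *m adj W = 1%:M ->
  re (\tr (M *m (adj W *m dgT h *m W))) =
  \sum_x \sum_y r x * nsq (entry (U *m adj W) x y) * h y.
Proof.
move=> [hU hM] hW.
have -> : \tr (M *m (adj W *m dgT h *m W)) =
    \tr (dgT r *m ((U *m adj W) *m dgT h *m adj (U *m adj W))).
  by rewrite hM mxtrace_conj adjM adjK !mulmxA.
rewrite tr_entry re_sum; apply: eq_bigr => x _.
rewrite entry_mul (bigD1 x) //= big1 ?addr0; last first.
  by move=> z hz; rewrite entry_dgT eq_sym (negPf hz) mulr0n mul0r.
rewrite entry_dgT eqxx mulr1n reZ entry_mul re_sum mulr_sumr; apply: eq_bigr => y _.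
rewrite entry_mul (bigD1 y) //= big1 ?addr0; last first.
  by move=> z hz; rewrite entry_dgT (negPf hz) mulr0n mulr0.
rewrite entry_dgT eqxx mulr1n entry_adj mulrAC -nsqE mulrC reZ /re /=; ring.
Qed.

Lemma tr_fun_self T (M U : op R T) r h : specT M U r ->
  re (\tr (M *m (adj U *m dgT h *m U))) = \sum_x r x * h x.
Proof.
move=> hM; rewrite (tr_fun_basis h hM hM.1) hM.1; apply: eq_bigr => x _.
rewrite (bigD1 x) //= big1 ?addr0 => [|y hy]; rewrite entry1.
  by rewrite eqxx nsq1 mulr1.
by rewrite eq_sym (negPf hy) nsq0 mulr0 mul0r.
Qed.

Lemma mxlog_specT T (M U : op R T) r : specT M U r -> mxlog M = adj U *m dgT (@logr R \o r) *m U.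
Proof. exact: mxfun_spec. Qed.

Lemma entropy_specT T (M U : op R T) r : specT M U r ->
  vN_entropy M = - \sum_x r x * logr (r x).
Proof. by move=> h; rewrite /vN_entropy (mxlog_specT h) (tr_fun_self _ h). Qed.

Lemma trace_specT T (M U : op R T) r : specT M U r -> re (\tr M) = \sum_x r x.
Proof.
move=> h; rewrite -[M in LHS]mulmx1 -(unit_adj h.1) -[adj U in LHS]mulmx1 -dgT1.
by rewrite (tr_fun_self _ h); apply: eq_bigr => x _; rewrite mulr1.
Qed.

Lemma conj_shift n (A B U W : 'M[C]_n) c : U *m adj U = 1%:M -> W *m adj W = 1%:M ->
  U *m (adj U *m A *m U - adj W *m B *m W - c%:M) *m adj W =
  A *m (U *m adj W) - (U *m adj W) *m B - c *: (U *m adj W).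
Proof.
move=> h1 h2; rewrite !mulmxBr !mulmxBl mul_mx_scalar -scalemxAl; congr (_ - _ - _).
  by rewrite !mulmxA h1 mul1mx.
by rewrite -!mulmxA h2 mulmx1.
Qed.

Variables (TA TB : finType) (rho : op R (TA * TB)%type).
Hypothesis hrho : density rho.
Local Notation T := (TA * TB)%type.
Local Notation sigma := (tens (ptrB rho) (ptrA rho)).

Variables (U : op R T) (WA : op R TA) (WB : op R TB).
Variables (r : T -> R) (sA : TA -> R) (sB : TB -> R).
Hypotheses (hU : specT rho U r) (hA : specT (ptrB rho) WA sA) (hB : specT (ptrA rho) WB sB).
Hypotheses (r0 : forall x, 0 <= r x) (sA0 : forall x, 0 <= sA x) (sB0 : forall x, 0 <= sB x).
Let W := tens WA WB.
Let s (y : T) := sA y.1 * sB y.2.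
Let hW : specT sigma W s := spec_tens hA hB.

Definition ns_p (z : (T * T)%type) : R := r z.1 * nsq (entry (U *m adj W) z.1 z.2).
Definition ns_Z (z : (T * T)%type) : R := logr (r z.1) - logr (s z.2).

Lemma ns_p_ge0 z : 0 <= ns_p z.
Proof. by rewrite mulr_ge0 ?nsq_ge0. Qed.

Let unitUW : (U *m adj W) *m adj (U *m adj W) = 1%:M.
Proof. by rewrite adjM adjK !mulmxA -(mulmxA U) (unit_adj hW.1) mulmx1 hU.1. Qed.

Lemma ns_left h : \sum_z ns_p z * h z.1 = \sum_x r x * h x.
Proof.
rewrite sum_pair; apply: eq_bigr => x _.
rewrite /ns_p /=; under eq_bigr do rewrite mulrAC; by rewrite -mulr_sumr (unitary_row x unitUW) mulr1.
Qed.

Lemma ns_right h : \sum_z ns_p z * h z.2 = re (\tr (rho *m (adj W *m dgT h *m W))).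
Proof. by rewrite (tr_fun_basis h hU hW.1) sum_pair. Qed.

(** The A-part of the second index is distributed as the spectrum of the marginal: a function of the
    marginal tensored with 1 sees [rho] only through its partial trace. *)
Lemma ns_rightA h : \sum_z ns_p z * h z.2.1 = \sum_a sA a * h a.
Proof.
rewrite (ns_right (fun y => h y.1)) -(tr_fun_self h hA) -tr_ptrB; congr (re (\tr (_ *m _))).
have -> : dgT (fun y : T => h y.1) = tens (dgT h) (dgT (fun=> 1)).
  by rewrite tens_dg; congr dgT; apply/funext => y; rewrite mulr1.
by rewrite /W -tens_adj -!tens_mul dgT1 mulmx1 (unit_adj hB.1).
Qed.

Lemma ns_rightB h : \sum_z ns_p z * h z.2.2 = \sum_b sB b * h b.
Proof.
rewrite (ns_right (fun y => h y.2)) -(tr_fun_self h hB) -tr_ptrA; congr (re (\tr (_ *m _))).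
have -> : dgT (fun y : T => h y.2) = tens (dgT (fun=> 1)) (dgT h).
  by rewrite tens_dg; congr dgT; apply/funext => y; rewrite mul1r.
by rewrite /W -tens_adj -!tens_mul dgT1 mulmx1 (unit_adj hA.1).
Qed.

Lemma ns_sum : \sum_z ns_p z = 1.
Proof.
have := ns_left (fun=> 1); under eq_bigr do rewrite mulr1.
under [RHS]eq_bigr do rewrite mulr1.
by move=> ->; rewrite -(trace_specT hU) hrho.2.
Qed.

(** Each of the three indices has the corresponding spectrum as its marginal law, so an index with
    eigenvalue 0 has total weight 0. This is the inclusion of the support of [rho] in that of the
    product of its marginals. *)
Lemma ns_supp z : ns_p z != 0 -> [/\ 0 < r z.1, 0 < sA z.2.1 & 0 < sB z.2.2].
Proof.
have hz (Y : finType) (f : (T * T)%type -> Y) (t : Y -> R) : (forall y, 0 <= t y) ->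
   (forall h, \sum_z ns_p z * h (f z) = \sum_y t y * h y) -> ns_p z != 0 -> 0 < t (f z).
  move=> t0 hs hp; rewrite lt_neqAle t0 andbT eq_sym; apply: contraNneq hp => e.
  have := hs (fun y => (y == f z)%:R); rewrite [RHS](bigD1 (f z)) //= e mul0r add0r.
  rewrite [RHS]big1 => [|y /negPf->]; last by rewrite mulr0.
  move/eqP; rewrite psumr_eq0 => [|x _]; last by rewrite mulr_ge0 ?ns_p_ge0.
  by move=> /allP/(_ z); rewrite mem_index_enum eqxx mulr1; apply.
move=> hp; split.
- exact: (hz _ (fun z => z.1) r r0 ns_left).
- exact: (hz _ (fun z => z.2.1) sA sA0 ns_rightA).
- exact: (hz _ (fun z => z.2.2) sB sB0 ns_rightB).
Qed.

Lemma logr_pos (x : R) : 0 < x -> logr x = ln x.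
Proof. by rewrite /logr => ->. Qed.

Lemma ns_mean : \sum_z ns_p z * ns_Z z = mutinf rho.
Proof.
rewrite /mutinf (entropy_specT hU) (entropy_specT hA) (entropy_specT hB).
rewrite -(ns_left (fun x => logr (r x))) -(ns_rightA (fun a => logr (sA a))) -(ns_rightB (fun b => logr (sB b))).
rewrite -!sumrN -!big_split /=; apply: eq_bigr => z _.
have [->|/ns_supp [h1 h2 h3]] := eqVneq (ns_p z) 0; first by rewrite !mul0r !oppr0 !addr0.
by rewrite /ns_Z /s (logr_pos (mulr_gt0 h2 h3)) lnM // !logr_pos //; ring.
Qed.

(** The operator X in [mutinf_var] is hermitian, so the variance is the sum of r_x times squared
    entries of U X [adj W]. Each logarithm is diagonal on its own side, so entry (x, y) is that of U
    [adj W] times the centred [ns_Z]. *)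
Lemma ns_var : \sum_z ns_p z * (ns_Z z - mutinf rho) ^+ 2 = mutinf_var rho.
Proof.
rewrite /mutinf_var (mxlog_specT hU) (mxlog_specT hW).
set X := _ - _ - _.
have hX : adj X = X.
  rewrite /X !adjB !adjM !adjK !adj_dg !mulmxA -scalemx1 adjCZ adjC1 conj_c //.
rewrite (_ : X *m X = X *m adj X); last by rewrite hX.
rewrite (tr_spec _ hU) sum_op_enum sum_pair; apply: eq_bigr => x _ /=.
rewrite enum_rankK (nrm2_row_unitary _ _ _ hW.1) sum_op_enum mulr_sumr; apply: eq_bigr => y _.
have -> : U *m X *m adj W = dgT (@logr R \o r) *m (U *m adj W) - (U *m adj W) *m dgT (@logr R \o s)
    - (mutinf rho)%:c *: (U *m adj W).
  exact: conj_shift hU.1 hW.1.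
rewrite -/(entry _ x y) !entryB entryZ !entry_mul.
rewrite (bigD1 x) //= big1 ?addr0; last first.
  by move=> z hz; rewrite entry_dgT eq_sym (negPf hz) mulr0n mul0r.
rewrite (bigD1 y) //= big1 ?addr0; last first.
  by move=> z hz; rewrite entry_dgT (negPf hz) mulr0n mulr0.
rewrite !entry_dgT !eqxx !mulr1n -entry_mul /ns_p /ns_Z /=.
case: (entry _ x y) => a b; rewrite /nsq /=; ring.
Qed.

(** * The n-fold distribution and its threshold event *)

Section NFold.
Variables (n : nat).
Local Notation fT := {ffun 'I_n -> T}.
Local Notation fst_ h := [ffun k => (h k).1].
Local Notation snd_ h := [ffun k => (h k).2].

Definition ns_rn (f : fT) : R := \prod_k r (f k).
Definition ns_sn (f : fT) : R := \prod_k s (f k).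

Lemma ns_iid (h : {ffun 'I_n -> (T * T)%type}) :
  iid ns_p h = ns_rn (fst_ h) * nsq (entry (tpow n U *m adj (tpow n W)) (fst_ h) (snd_ h)).
Proof.
rewrite -tpow_adj -tpow_mul entry_tpow nsq_prod /ns_rn -big_split.
by apply: eq_bigr => k _; rewrite !ffunE.
Qed.

(** Logarithms turn the products into sums. Nonzero weight makes every eigenvalue positive by
    [ns_supp], so that [logr] is [ln] here. *)
Lemma ns_event (h : {ffun 'I_n -> (T * T)%type}) b : iid ns_p h != 0 ->
  (ns_rn (fst_ h) <= expR (n%:R * (mutinf rho - b)) * ns_sn (snd_ h)) =
  (tot (fun z => ns_Z z - mutinf rho) h <= - (n%:R * b)).
Proof.
move=> /prodf_neq0 hp.
have hk k := ns_supp (hp k isT).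
have -> : ns_rn (fst_ h) = expR (\sum_k logr (r (h k).1)).
  rewrite expR_sum; apply: eq_bigr => k _; rewrite ffunE.
  by case: (hk k) => h1 _ _; rewrite logr_pos // lnK.
have -> : ns_sn (snd_ h) = expR (\sum_k logr (s (h k).2)).
  rewrite expR_sum; apply: eq_bigr => k _; rewrite ffunE.
  by case: (hk k) => _ h2 h3; rewrite logr_pos ?lnK ?posrE //; apply: mulr_gt0.
rewrite -expRD ler_expR /tot sumrB sumr_const card_ord -mulr_natl sumrB.
by rewrite -subr_ge0 -[RHS]subr_ge0; congr (0 <= _); ring.
Qed.

Lemma sum_pair_ffun (Q : fT -> fT -> bool) (F : fT -> fT -> R) :
  \sum_f \sum_(g | Q f g) F f g =
  \sum_(h : {ffun 'I_n -> (T * T)%type} | Q (fst_ h) (snd_ h)) F (fst_ h) (snd_ h).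
Proof.
under eq_bigr do rewrite big_mkcond.
by rewrite -(@sum_ffun_pair _ _ _ _ (fun f g => if Q f g then F f g else 0)) -big_mkcond.
Qed.

Lemma ns_rn_ge0 f : 0 <= ns_rn f. Proof. exact: prodr_ge0. Qed.
Lemma ns_sn_ge0 f : 0 <= ns_sn f.
Proof. by apply: prodr_ge0 => k _; apply: mulr_ge0. Qed.

(** On the event the minimum of r and lam s is r, so the sum of the minima dominates the probability
    of the event. *)
Lemma nfold_error_lower b (Tn : op R fT) : test Tn ->
  \sum_(h : {ffun 'I_n -> (T * T)%type} | tot (fun z => ns_Z z - mutinf rho) h <= - (n%:R * b)) iid ns_p h <=
  2 * (re (\tr (tpow n rho *m (1%:M - Tn))) +
       expR (n%:R * (mutinf rho - b)) * re (\tr (tpow n sigma *m Tn))).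
Proof.
move=> [h1 h2].
have := nussbaum_szkola_lower (spec_tpow n hU) (spec_tpow n hW) _ _ (expR_ge0 (n%:R * (mutinf rho - b))) h1 h2.
move=> hh; apply: le_trans (hh _ _) => {hh}; last 2 first.
- by move=> i; apply: ns_rn_ge0.
- by move=> i; apply: ns_sn_ge0.
rewrite sum_op_enum; under [leRHS]eq_bigr do rewrite sum_op_enum.
have := sum_pair_ffun (fun _ _ => true) (fun f g =>
   nsq (entry (tpow n U *m adj (tpow n W)) f g) * Num.min (ns_rn f) (expR (n%:R * (mutinf rho - b)) * ns_sn g)).
under eq_bigr do under eq_bigr do rewrite /entry.
move=> e; rewrite [leRHS](_ : _ = \sum_f \sum_g nsq (entry (tpow n U *m adj (tpow n W)) f g) *
   Num.min (ns_rn f) (expR (n%:R * (mutinf rho - b)) * ns_sn g)); last first.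
  by apply: eq_bigr => f _; apply: eq_bigr => g _; rewrite /= !enum_rankK.
rewrite e [leLHS]big_mkcond; apply: ler_sum => h _.
have m0 : 0 <= Num.min (ns_rn (fst_ h)) (expR (n%:R * (mutinf rho - b)) * ns_sn (snd_ h)).
  by rewrite le_min ns_rn_ge0 mulr_ge0 ?expR_ge0 ?ns_sn_ge0.
case: ifP => ht; last by rewrite mulr_ge0 ?nsq_ge0.
have [->|hp] := eqVneq (iid ns_p h) 0; first by rewrite mulr_ge0 ?nsq_ge0.
by move: ht; rewrite -(ns_event _ hp) => /min_idPl ->; rewrite ns_iid mulrC.
Qed.

Lemma nfold_test b : exists Tn : op R fT, [/\ test Tn,
  re (\tr (tpow n rho *m (1%:M - Tn))) <=
    \sum_(h : {ffun 'I_n -> (T * T)%type} | tot (fun z => ns_Z z - mutinf rho) h <= - (n%:R * b)) iid ns_p h &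
  re (\tr (tpow n sigma *m Tn)) <= expR (- (n%:R * (mutinf rho - b)))].
Proof.
have [hUn1 hUn2] := spec_tpow n hU; have [hWn1 hWn2] := spec_tpow n hW.
have [|Tn [t1 t2 t3 t4]] := @nussbaum_szkola_test _ _ _ _ (ns_rn \o enum_val) (ns_sn \o enum_val)
  (expR (n%:R * (mutinf rho - b))) hUn1 hWn1.
  by move=> i; apply: ns_rn_ge0.
exists Tn; split; first by split.
- rewrite hUn2; apply: le_trans t3 _.
  rewrite sum_op_enum.
  rewrite [leLHS](_ : _ = \sum_f \sum_(g | ns_rn f <= expR (n%:R * (mutinf rho - b)) * ns_sn g)
     ns_rn f * nsq (entry (tpow n U *m adj (tpow n W)) f g)); last first.
    by apply: eq_bigr => f _; rewrite sum_op_enum_cond /= enum_rankK; apply: eq_bigl => g; rewrite enum_rankK.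
  rewrite sum_pair_ffun big_mkcond [leRHS]big_mkcond; apply: ler_sum => h _.
  rewrite -ns_iid; have [->|hp] := eqVneq (iid ns_p h) 0; first by rewrite !if_same.
  by rewrite (ns_event _ hp).
- rewrite hWn2 expRN -[leRHS]mulr1 mulrC ler_pdivlMr ?expR_gt0 // mulrC.
  apply: le_trans t4 _; rewrite sum_op_enum.
  have -> : \sum_x (ns_rn \o enum_val) (enum_rank x) = re (\tr (tpow n rho)).
    rewrite (trace_specT (spec_tpow n hU)); apply: eq_bigr => x _; by rewrite /= enum_rankK.
  by rewrite (density_tpow n hrho).2.
Qed.

End NFold.
End NussbaumSzkola.

(** * Error bounds at moderate rates *)

Section Exponents.
Variable R : realType.
Local Notation C := R[i].
Local Notation "x %:c" := (Complex x (0:R)) (at level 2, format "x %:c").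
Variables (TA TB : finType) (rho : op R (TA * TB)%type).
Hypothesis hrho : density rho.
Hypothesis hV : 0 < mutinf_var rho.
Local Notation T := (TA * TB)%type.
Local Notation sigma := (tens (ptrB rho) (ptrA rho)).
Local Notation I := (mutinf rho).
Local Notation V := (mutinf_var rho).

Lemma moderate_deviation_test e : 0 < e -> e < 1 -> exists2 b0 : R, 0 < b0 & exists N0 : R,
  forall b n, 0 < b -> b <= b0 -> 
  (N0 <= n%:R * b ^+ 2 -> forall Tn : op R {ffun 'I_n -> T}, test Tn ->
    expR (- (n%:R * b ^+ 2 * (1 + e) / (2 * V))) <=
    2 * (re (\tr (tpow n rho *m (1%:M - Tn))) +
       expR (n%:R * (I - b)) * re (\tr (tpow n sigma *m Tn)))) /\
  (exists Tn : op R {ffun 'I_n -> T}, [/\ test Tn,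
    re (\tr (tpow n rho *m (1%:M - Tn))) <= expR (- (n%:R * b ^+ 2 * (1 - e) / (2 * V))) &
    re (\tr (tpow n sigma *m Tn)) <= expR (- (n%:R * (I - b)))]).
Proof.
move=> e0 e1.
have [U [r [hU r0]]] := psd_specT hrho.1.
have [WA [sA [hA sA0]]] := psd_specT (density_ptrB hrho).1.
have [WB [sB [hB sB0]]] := psd_specT (density_ptrA hrho).1.
pose p := ns_p U WA WB r.
pose Z z := ns_Z r sA sB z - I.
have p0 : forall z, 0 <= p z by apply: ns_p_ge0.
have p1 : \sum_z p z = 1 by apply: (ns_sum hrho hU hA hB).
have mZ : \sum_z p z * Z z = 0.
  rewrite /Z; under eq_bigr do rewrite mulrBr.
  by rewrite sumrB -mulr_suml p1 mul1r (ns_mean hU hA hB r0 sA0 sB0) subrr.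
have vZ : \sum_z p z * Z z ^+ 2 = V by apply: (ns_var hU hA hB).
pose K : R := 1 + \sum_z `|Z z|.
have K0 : 0 < K by rewrite ltr_pwDl // sumr_ge0.
have ZK : forall z, `|Z z| <= K.
  move=> z; rewrite /K (bigD1 z) //= addrCA lerDl addr_ge0 // sumr_ge0 //.
have [b1 b10 hlow] := moderate_deviation_lower p0 p1 mZ vZ hV K0 ZK e0 e1.
have [b2 b20 hup] := moderate_deviation_upper p0 p1 mZ vZ hV K0 ZK e0 e1.
have [N0 {}hlow] := hlow.
exists (Num.min b1 b2); first by rewrite lt_min b10.
exists N0 => b n bp; rewrite le_min => /andP[hb1 hb2]; split.
  move=> hN Tn hT; apply: le_trans (hlow b n bp hb1 hN) _.
  exact: (nfold_error_lower hU hA hB r0 sA0 sB0 b hT).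
have [Tn [t1 t2 t3]] := nfold_test hrho hU hA hB r0 sA0 sB0 n b.
by exists Tn; split => //; apply: le_trans t2 (hup _ _ _ _).
Qed.

Lemma type1_error_ge0 n (Tn : op R {ffun 'I_n -> T}) : test Tn ->
  0 <= re (\tr (tpow n rho *m (1%:M - Tn))).
Proof. by move=> [h1 h2]; apply: tr_psd_mul h2; apply: psd_tpow; case: hrho. Qed.

Lemma test0 (X : finType) : test (0 : op R X).
Proof. by split; [exact: psd0|rewrite subr0; exact: psd1]. Qed.

Lemma alpha_iid_ge n mu x : 
  0 <= mu ->
  (forall Tn : op R {ffun 'I_n -> T}, test Tn -> re (\tr (tpow n sigma *m Tn)) <= mu ->
     x <= re (\tr (tpow n rho *m (1%:M - Tn)))) ->
  x <= alpha_hat_iid rho n mu.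
Proof.
move=> hmu h; apply: lb_le_inf.
  (* The zero test is admissible because [0 <= mu], so the infimum is taken over a nonempty set. *)
  exists (re (\tr (tpow n rho *m (1%:M - 0)))), 0; split => //; first exact: test0.
  by move=> S U _ _; rewrite mulmx0 mxtrace0.
move=> _ [Tn [t1 t2 ->]]; apply: h => //.
have := t2 _ _ (density_ptrB hrho) (density_ptrA hrho); by rewrite tens_n_tpow.
Qed.

Lemma alpha_hat_le n mu (Tn : op R {ffun 'I_n -> T}) : test Tn ->
  (forall (S : op R {ffun 'I_n -> TA}) (U : op R {ffun 'I_n -> TB}),
     sym_density S -> sym_density U -> re (\tr (tens_n S U *m Tn)) <= mu) ->
  alpha_hat rho n mu <= re (\tr (tpow n rho *m (1%:M - Tn))).
Proof.
move=> h1 h2; apply: ge_inf; last by exists Tn.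
by exists 0 => _ [Q [q1 q2 ->]]; apply: type1_error_ge0.
Qed.

Lemma alpha_iid_le_hat n mu : 0 <= mu -> alpha_hat_iid rho n mu <= alpha_hat rho n mu.
Proof.
move=> hmu; apply: lb_le_inf.
  exists (re (\tr (tpow n rho *m (1%:M - 0)))), 0; split => //; first exact: test0.
  by move=> S U _ _; rewrite mulmx0 mxtrace0.
move=> _ [Tn [t1 t2 ->]]; apply: ge_inf.
  by exists 0 => _ [Q [q1 q2 ->]]; apply: type1_error_ge0.
exists Tn; split => // S U hS hU; apply: t2.
  by split; [exact: density_tpow|exact: perm_inv_tpow].
by split; [exact: density_tpow|exact: perm_inv_tpow].
Qed.

(** With lam = e^(n (I - b)), the type-II term is at most lam e^(- n (I - a)) = e^(- n (b - a)),
    which becomes negligible once b exceeds a. *)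
Lemma alpha_iid_lower e : 0 < e -> e < 1 -> exists2 b0 : R, 0 < b0 & exists N0 : R,
  forall (a b : R) n, 0 < b -> b <= b0 -> N0 <= n%:R * b ^+ 2 ->
   expR (- (n%:R * b ^+ 2 * (1 + e) / (2 * V))) / 2 - expR (- (n%:R * (b - a)))
   <= alpha_hat_iid rho n (expR (- (n%:R * (I - a)))).
Proof.
move=> e0 e1; have [b0 b00 [N0 h]] := moderate_deviation_test e0 e1.
exists b0 => //; exists N0 => a b n bp hb hN.
apply: alpha_iid_ge => [|Tn hT hmu]; first exact: expR_ge0.
have [/(_ hN _ hT) h1 _] := h b n bp hb.
have := ler_wpM2l (expR_ge0 (n%:R * (I - b))) hmu.
rewrite -expRD; have -> : n%:R * (I - b) + - (n%:R * (I - a)) = - (n%:R * (b - a)) by ring.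
by clear -h1; lra.
Qed.

Definition poly_dim (n : nat) : R := (n.+1 ^ #|{: TA * TA}| + n.+1 ^ #|{: TB * TB}|)%:R.

(** The shift 2 d is the price of the two cuts, a factor e^(n d) for A and another for B; the
    prefactors 2 and 3 are those of [gentle]. *)
Lemma alpha_hat_upper e : 0 < e -> e < 1 -> exists2 b0 : R, 0 < b0 &
  forall (d b : R) n, 0 < b -> b <= b0 ->
   alpha_hat rho n (expR (- (n%:R * (I - (b + 2 * d))))) <=
   2 * expR (- (n%:R * b ^+ 2 * (1 - e) / (2 * V))) + 3 * (poly_dim n * expR (- (n%:R * d))).
Proof.
move=> e0 e1; have [b0 b00 [N0 h]] := moderate_deviation_test e0 e1.
exists b0 => // d b n bp hb.
have [_ [Tn [[t1 t2] t3 t4]]] := h b n bp hb.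
pose c : R := expR (n%:R * d).
have cp : 0 < c by apply: expR_gt0.
have [PA [A1 A2 A3 A4]] := universal_cut n (ltW cp) (density_ptrB hrho).
have [PB [B1 B2 B3 B4]] := universal_cut n (ltW cp) (density_ptrA hrho).
pose P := tens_n PA PB.
have P1 : adj P = P by rewrite /P -tens_n_adj A1 B1.
have P2 : P *m P = P by rewrite /P -tens_n_mul A2 B2.
have rhon : psd (tpow n rho) by apply: psd_tpow; case: hrho.
have [pA pA'] := proj_psd A1 A2; have [pB pB'] := proj_psd B1 B2.
have hP : re (\tr (tpow n rho *m (1%:M - P))) <= poly_dim n * expR (- (n%:R * d)).
  (* An operator union bound: the complement of the product cut is at most the sum of the two local
     complements, whose weights depend on the marginals only. *)
  have e2 : 1%:M - P = tens_n (1%:M - PA) 1%:M + tens_n PA (1%:M - PB).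
    by rewrite tens_nBl tens_nBr tens_n1 addrA subrK.
  have h3 : psd ((tens_n (1%:M - PA) 1%:M + tens_n 1%:M (1%:M - PB)) - (1%:M - P)).
    rewrite e2 opprD addrACA subrr add0r -tens_nBl; exact: psd_tens_n.
  apply: le_trans (tr_psd_le_r rhon h3) _.
  rewrite mulmxDr mxtraceD reD tr_ptrB_n tr_ptrA_n /poly_dim natrD mulrDl expRN -/c.
  by rewrite lerD // ler_pdivlMr // mulrC.
have hT : test (P *m Tn *m P).
  split; first by have := psd_conj P t1; rewrite P1.
  have -> : 1%:M - P *m Tn *m P = (1%:M - P) + P *m (1%:M - Tn) *m adj P.
    by rewrite P1 mulmxBr mulmx1 mulmxBl P2 addrA subrK.
  apply: psdD; [by case: (proj_psd P1 P2)|exact: psd_conj].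
apply: le_trans (@alpha_hat_le _ _ (P *m Tn *m P) hT _) _; last first.
  have := gentle rhon t1 t2 P1 P2.
  move: (re (\tr (tpow n rho *m (1%:M - P *m Tn *m P)))) => x; clear -t3 hP; lra.
move=> S U hS hU.
(* Cyclicity moves the cut from the test to the symmetric states, where the domination by c times
   the marginal power applies. *)
have e1' : \tr (tens_n S U *m (P *m Tn *m P)) = \tr (tens_n (PA *m S *m PA) (PB *m U *m PB) *m Tn).
  by rewrite !tens_n_mul -/P !mulmxA mxtrace_mulC !mulmxA.
rewrite e1'.
have hle : psd (tens_n (c%:c *: tpow n (ptrB rho)) (c%:c *: tpow n (ptrA rho)) -
   tens_n (PA *m S *m PA) (PB *m U *m PB)).
  apply: tens_n_le (A3 _ hS) (B3 _ hU).
    by have := psd_conj PA hS.1.1; rewrite A1.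
  by apply: psdZ (ltW cp) _; apply: psd_tpow; case: (density_ptrA hrho).
apply: le_trans (tr_psd_le hle t1) _.
rewrite tens_nZ -scalemxAl mxtraceZ -cM reZ tens_n_tpow.
apply: le_trans (ler_wpM2l _ t4) _; first by rewrite mulr_ge0 // ltW.
rewrite /c -!expRD ler_expR le_eqVlt; apply/orP; left; apply/eqP; ring.
Qed.

End Exponents.

(** * Asymptotics *)

Section Asymptotics.
Variable R : realType.

(** From n + 1 <= (1 + sqrt n)^2. A logarithm would be sharper, but sqrt n is directly comparable
    with n a_n under the growth hypothesis on sqrt n a_n. *)
Lemma natX_le_expR (n k : nat) : (n.+1 ^ k)%:R <= expR (2 * k%:R * Num.sqrt n%:R) :> R.
Proof.
have s0 : 0 <= Num.sqrt n%:R :> R by apply: sqrtr_ge0.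
have h1 : (n.+1)%:R <= expR (2 * Num.sqrt n%:R) :> R.
  rewrite mulr_natl mulr2n expRD.
  have h := expR_ge1Dx (Num.sqrt n%:R : R).
  apply: (@le_trans _ _ ((1 + Num.sqrt n%:R) * (1 + Num.sqrt n%:R))).
    rewrite -natr1 -[n%:R in leLHS](@sqr_sqrtr R) //; nra.
  by apply: ler_pM => //; rewrite addr_ge0.
have -> : 2 * k%:R * Num.sqrt n%:R = k%:R * (2 * Num.sqrt n%:R) :> R by ring.
by rewrite natrX expRM_natl; apply: lerXn2r => //; rewrite nnegrE ?expR_ge0.
Qed.

Lemma expR_quarter (x : R) : 2 <= x -> expR (- x) <= 1 / 4.
Proof.
move=> hx; have := @expR_le_half R (x / 2) ltac:(lra).
have -> : - x = - (x / 2) + - (x / 2) by field.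
rewrite expRD; have := expR_gt0 (- (x / 2)); nra.
Qed.

Lemma expR3_ge6 : 6 <= expR 3 :> R.
Proof.
have -> : 3 = 1 + (1 + 1) :> R by lra.
have := @expR_ge1Dx R 1; rewrite !expRD; nra.
Qed.

(** Half of e covers the passage from B to A, the other half makes the left side at most a quarter
    of e^(- u A). The subtracted term is also at most a quarter, which leaves 1 / 2 - 1 / 4. *)
Lemma exponent_absorb_lower (u A B e y : R) : 0 <= u -> A <= B + e / 2 ->
  2 <= u * (e / 2) -> u * A <= y / 2 -> 2 <= y / 2 ->
  expR (- (u * (B + e))) <= expR (- (u * A)) / 2 - expR (- y).
Proof.
move=> u0 hA he hy y2; have q0 := expR_gt0 (- (u * A)).
have g1 : expR (- y) <= expR (- (u * A)) / 4.
  have : expR (- y) <= expR (- (u * A)) * expR (- (y / 2)) by rewrite -expRD ler_expR; lra.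
  have := expR_quarter y2; nra.
have g2 : expR (- (u * (B + e))) <= expR (- (u * A)) / 4.
  have : expR (- (u * (B + e))) <= expR (- (u * A)) * expR (- (u * (e / 2))).
    by rewrite -expRD ler_expR; have := ler_wpM2l u0 hA; lra.
  have := expR_quarter he; nra.
lra.
Qed.

(** The same halving of e: the left side is at most three copies of e^(- u A), each at most a
    quarter of the target. *)
Lemma exponent_absorb_upper (u A B e z : R) : 0 <= u -> B - e / 2 <= A ->
  2 <= u * (e / 2) -> z <= expR (- (u * A)) ->
  2 * expR (- (u * A)) + z <= expR (- (u * (B - e))).
Proof.
move=> u0 hA he hz; have q0 := expR_gt0 (- (u * A)).
have : expR (- (u * A)) <= expR (- (u * (B - e))) * expR (- (u * (e / 2))).
  by rewrite -expRD ler_expR; have := ler_wpM2l u0 hA; lra.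
have := expR_quarter he; have := expR_gt0 (- (u * (B - e))); nra.
Qed.

Variable a : R^nat.
Hypothesis a0 : forall n, 0 < a n.
Hypothesis acvg : a @ \oo --> (0 : R).
Hypothesis agrow : (fun n => Num.sqrt (n%:R) * a n) @ \oo --> +oo.

Lemma near_small (x : R) : 0 < x -> \forall n \near \oo, a n <= x.
Proof.
move=> hx; have /cvgrPdist_le/(_ _ hx) := acvg; apply: filterS => n.
by rewrite sub0r normrN ger0_norm // ltW.
Qed.

Lemma near_large (x : R) : \forall n \near \oo, x <= Num.sqrt n%:R * a n.
Proof. exact: (cvgryPge (fun n => Num.sqrt n%:R * a n)).1. Qed.

Lemma near_large2 (x : R) : \forall n \near \oo, x <= n%:R * a n ^+ 2.
Proof.
apply: filterS (near_large (Num.max 1 x)) => n; rewrite ge_max => /andP[h1 h2].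
have -> : n%:R * a n ^+ 2 = (Num.sqrt n%:R * a n) ^+ 2 by rewrite exprMn sqr_sqrtr.
nra.
Qed.

Lemma near_sqrt (x : R) : \forall n \near \oo, x * (1 + Num.sqrt n%:R) <= n%:R * a n.
Proof.
near=> n.
have h1 : 2 * Num.max 1 x <= Num.sqrt n%:R * a n by near: n; apply: near_large.
have h2 : (0 < n)%N by near: n; apply: nbhs_infty_gt.
have m1 : 1 <= Num.max 1 x by rewrite le_max lexx.
have m2 : x <= Num.max 1 x by rewrite le_max lexx orbT.
have s1 : 1 <= Num.sqrt n%:R :> R by rewrite -[leLHS]sqrtr1 ler_sqrt // ?ler1n.
have -> : n%:R * a n = Num.sqrt n%:R * (Num.sqrt n%:R * a n).
  by rewrite mulrA -expr2 sqr_sqrtr.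
move: h1 m1 m2 s1; move: (Num.max 1 x) (Num.sqrt n%:R) (Num.sqrt n%:R * a n) => m s t h1 m1 m2 s1.
nra.
Unshelve. all: by end_near. Qed.

Lemma exponent_cvg (f : nat -> R) (D : R) : 
  (forall e, 0 < e -> \forall n \near \oo, expR (- (n%:R * a n ^+ 2 * (D + e))) <= f n) ->
  (forall e, 0 < e -> \forall n \near \oo, f n <= expR (- (n%:R * a n ^+ 2 * (D - e)))) ->
  (fun n => - ln (f n) / (n%:R * a n ^+ 2)) @ \oo --> D.
Proof.
move=> h1 h2; apply/cvgrPdist_le => e e0; near=> n.
have l1 : expR (- (n%:R * a n ^+ 2 * (D + e))) <= f n by near: n; apply: h1.
have l2 : f n <= expR (- (n%:R * a n ^+ 2 * (D - e))) by near: n; apply: h2.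
have u1 : 1 <= n%:R * a n ^+ 2 by near: n; apply: near_large2.
have u0 : 0 < n%:R * a n ^+ 2 by lra.
have f0 : 0 < f n by apply: lt_le_trans (expR_gt0 _) l1.
have k1 : - (n%:R * a n ^+ 2 * (D + e)) <= ln (f n) by rewrite -ler_expR lnK.
have k2 : ln (f n) <= - (n%:R * a n ^+ 2 * (D - e)) by rewrite -ler_expR lnK.
rewrite distrC ler_distl; apply/andP; split.
  by rewrite ler_pdivlMr // mulrC; lra.
by rewrite ler_pdivrMr // mulrC; lra.
Unshelve. all: by end_near. Qed.

Section Bounds.
Variables (TA TB : finType) (rho : op R (TA * TB)%type).
Hypothesis hrho : density rho.
Hypothesis hV : 0 < mutinf_var rho.
Local Notation V := (mutinf_var rho).
Local Notation mu n := (expR (- (n%:R * (mutinf rho - a n)))).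

(** Here D stands for 1 / (2 V). The squares come from b = (1 + d) a_n and b = (1 - 2 d) a_n, the
    single factors 1 + d and 1 - d from the moderate deviation bounds taken with error d. Both
    products are within 8 d of 1. *)
Lemma small_delta (e D : R) : 0 < e -> 0 < D ->
  exists d : R, [/\ 0 < d, d < 1 / 4, (1 + d) ^+ 2 * (1 + d) * D <= D + e &
    D - e <= (1 - 2 * d) ^+ 2 * (1 - d) * D].
Proof.
move=> e0 D0; exists (Num.min (1 / 8) (e / (8 * D))).
have x0 : 0 < e / (8 * D) by rewrite divr_gt0 // mulr_gt0.
have y0 : e / (8 * D) * D = e / 8 by field; rewrite gt_eqF.
set d := Num.min _ _.
have d0 : 0 < d by rewrite lt_min x0 andbT; lra.
have d1 : d <= 1 / 8 by rewrite ge_min lexx.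
have d2 : d <= e / (8 * D) by rewrite ge_min lexx orbT.
have dD : d * D <= e / 8 by rewrite -y0 ler_wpM2r // ltW.
split => //; first by lra.
- have : (1 + d) ^+ 2 * (1 + d) <= 1 + 8 * d by nra.
  by move=> /(ler_wpM2r (ltW D0)); lra.
- have : 1 - 8 * d <= (1 - 2 * d) ^+ 2 * (1 - d) by nra.
  by move=> /(ler_wpM2r (ltW D0)); lra.
Qed.

Lemma near_alpha_hat_iid_ge e : 0 < e -> \forall n \near \oo,
  expR (- (n%:R * a n ^+ 2 * ((2 * V)^-1 + e))) <= alpha_hat_iid rho n (mu n).
Proof.
move=> e0; have D0 : 0 < (2 * V)^-1 by rewrite invr_gt0 mulr_gt0.
have [d [d0 d1 hd _]] := small_delta (divr_gt0 e0 (ltr0Sn R 1)) D0.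
have [|b0 b00 [N0 h]] := alpha_iid_lower hrho hV d0; first by lra.
set A := _ * _ * _ in hd.
have A0 : 0 < A by rewrite /A !mulr_gt0 ?exprn_gt0 //; lra.
have f1 x : 0 < x -> x <= b0 / 2 -> 0 < (1 + d) * x /\ (1 + d) * x <= b0.
  by move=> x0 xb; split; nra.
have f2 : 1 <= (1 + d) ^+ 2 by nra.
near=> n.
have p0 := a0 n.
have u1 : 2 / (e / 2) <= n%:R * a n ^+ 2 by near: n; apply: near_large2.
have u2 : N0 <= n%:R * a n ^+ 2 by near: n; apply: near_large2.
have s1 : a n <= b0 / 2 by near: n; apply: near_small; lra.
(* Puts the main exponent u A below half of the margin d n a_n; this is where a_n -> 0 is used
   against n a_n^2. *)
have s2 : a n <= d / (2 * A) by near: n; apply: near_small; rewrite divr_gt0 // mulr_gt0.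
have l1 : 4 / d * (1 + Num.sqrt n%:R) <= n%:R * a n by near: n; apply: near_sqrt.
have q0 : 0 <= Num.sqrt n%:R :> R := sqrtr_ge0 _.
have n0 : 0 <= n%:R :> R by [].
have := h (a n) ((1 + d) * a n) n _ _ _.
have -> : n%:R * ((1 + d) * a n) ^+ 2 * (1 + d) / (2 * V) = n%:R * a n ^+ 2 * A.
  by rewrite /A; ring.
have -> : n%:R * ((1 + d) * a n - a n) = d * (n%:R * a n) by ring.
set u := n%:R * a n ^+ 2 in u1 u2 *.
have u0 : 0 <= u by rewrite /u mulr_ge0 ?sqr_ge0.
move=> {h} hh; apply: le_trans (hh _ _ _); last 3 first.
- exact: (f1 _ p0 s1).1.
- exact: (f1 _ p0 s1).2.
- apply: le_trans u2 _; have -> : n%:R * ((1 + d) * a n) ^+ 2 = u * (1 + d) ^+ 2 by rewrite /u; ring.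
  by rewrite ler_peMr.
clear hh f1.
have ul : u * A <= d / 2 * (n%:R * a n).
  have -> : u * A = (n%:R * a n) * (a n * A) by rewrite /u; ring.
  rewrite mulrC ler_wpM2r ?mulr_ge0 ?(ltW p0) //.
  have := ler_wpM2r (ltW A0) s2; rewrite (_ : d / (2 * A) * A = d / 2) //.
  by field; rewrite gt_eqF.
have l2 : 2 <= d * (n%:R * a n) / 2.
  have h4 : 0 < 4 / d by rewrite divr_gt0.
  have q1 : 1 <= 1 + Num.sqrt n%:R :> R by rewrite lerDl.
  have := le_trans (ler_wpM2l (ltW h4) q1) l1; rewrite mulr1 ler_pdivrMr //.
  by rewrite mulrC ler_pdivlMr // -natrM.
apply: exponent_absorb_lower => //; first by rewrite -ler_pdivrMr ?divr_gt0.
by apply: le_trans ul _; rewrite mulrAC.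
Unshelve. all: by end_near. Qed.

Lemma near_alpha_hat_le e : 0 < e -> \forall n \near \oo,
  alpha_hat rho n (mu n) <= expR (- (n%:R * a n ^+ 2 * ((2 * V)^-1 - e))).
Proof.
move=> e0; have D0 : 0 < (2 * V)^-1 by rewrite invr_gt0 mulr_gt0.
have [d [d0 d1 _ hd]] := small_delta (divr_gt0 e0 (ltr0Sn R 1)) D0.
have [|b0 b00 h] := alpha_hat_upper hrho hV d0; first by lra.
set A := _ * _ * _ in hd.
have A0 : 0 < A by rewrite /A !mulr_gt0 ?exprn_gt0 //; lra.
have f1 x : 0 < x -> x <= b0 -> 0 < (1 - 2 * d) * x /\ (1 - 2 * d) * x <= b0.
  by move=> x0 xb; split; nra.
(* Dominates the exponent from [natX_le_expR] for both A and B. The 3 added to k below pays the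
   prefactor: 3 times two terms is 6, at most e^3. *)
pose k : R := 2 * (#|{: TA * TA}|%:R + #|{: TB * TB}|%:R).
have k0 : 0 <= k by rewrite mulr_ge0 ?addr_ge0.
near=> n.
have p0 := a0 n.
have u1 : 2 / (e / 2) <= n%:R * a n ^+ 2 by near: n; apply: near_large2.
have s1 : a n <= b0 by near: n; apply: near_small.
have s2 : a n <= d / (2 * A) by near: n; apply: near_small; rewrite divr_gt0 // mulr_gt0.
(* Half of the margin d n a_n absorbs the polynomial factor; the other half still exceeds u A. *)
have l1 : (k + 3) * (2 / d) * (1 + Num.sqrt n%:R) <= n%:R * a n by near: n; apply: near_sqrt.
have q0 : 0 <= Num.sqrt n%:R :> R := sqrtr_ge0 _.
have n0 : 0 <= n%:R :> R by [].
have := h (d * a n) ((1 - 2 * d) * a n) n _ _.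
have -> : (1 - 2 * d) * a n + 2 * (d * a n) = a n by ring.
have -> : n%:R * ((1 - 2 * d) * a n) ^+ 2 * (1 - d) / (2 * V) = n%:R * a n ^+ 2 * A.
  by rewrite /A; ring.
have -> : n%:R * (d * a n) = d * (n%:R * a n) by ring.
set u := n%:R * a n ^+ 2 in u1 *.
have u0 : 0 <= u by rewrite /u mulr_ge0 ?sqr_ge0.
move=> {h} hh; apply: le_trans (hh _ _) _.
- exact: (f1 _ p0 s1).1.
- exact: (f1 _ p0 s1).2.
clear hh f1.
have ul : u * A <= d / 2 * (n%:R * a n).
  have -> : u * A = (n%:R * a n) * (a n * A) by rewrite /u; ring.
  rewrite mulrC ler_wpM2r ?mulr_ge0 ?(ltW p0) //.
  have := ler_wpM2r (ltW A0) s2; rewrite (_ : d / (2 * A) * A = d / 2) //.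
  by field; rewrite gt_eqF.
have l2 : (k + 3) * (1 + Num.sqrt n%:R) <= d / 2 * (n%:R * a n).
  have := ler_wpM2l (ltW (divr_gt0 d0 (ltr0Sn R 1))) l1.
  rewrite (_ : d / 2 * ((k + 3) * (2 / d) * (1 + Num.sqrt n%:R)) = (k + 3) * (1 + Num.sqrt n%:R)) //.
  by field; rewrite gt_eqF.
have hpoly : 3 * poly_dim R TA TB n <= expR ((k + 3) * (1 + Num.sqrt n%:R)).
  have hx (m : nat) : 2 * m%:R <= k -> (n.+1 ^ m)%:R <= expR (k * Num.sqrt n%:R).
    move=> hm; apply: le_trans (natX_le_expR n m) _.
    by rewrite ler_expR ler_wpM2r.
  have x1 := hx #|{: TA * TA}| _; have x2 := hx #|{: TB * TB}| _.
  have y1 : 2 * #|{: TA * TA}|%:R <= k by rewrite /k mulrDr lerDl mulr_ge0.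
  have y2 : 2 * #|{: TB * TB}|%:R <= k by rewrite /k mulrDr lerDr mulr_ge0.
  apply: (@le_trans _ _ (expR 3 * expR (k * Num.sqrt n%:R))); last first.
    rewrite -expRD ler_expR; nra.
  apply: (@le_trans _ _ (6 * expR (k * Num.sqrt n%:R))); last by rewrite ler_wpM2r ?expR_ge0 ?expR3_ge6.
  rewrite /poly_dim natrD; have := x1 y1; have := x2 y2; lra.
have g1 : 3 * (poly_dim R TA TB n * expR (- (d * (n%:R * a n)))) <= expR (- (u * A)).
  rewrite mulrA; apply: le_trans (ler_wpM2r (expR_ge0 _) hpoly) _.
  by rewrite -expRD ler_expR; lra.
apply: exponent_absorb_upper => //.
by rewrite -ler_pdivrMr ?divr_gt0.
Unshelve. all: by end_near. Qed.

End Bounds.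
End Asymptotics.

Theorem mainTheorem5 (R : realType) (TA TB : finType)
    (a : R ^nat) (rho : op R (TA * TB)%type) :
  (forall n, 0 < a n) ->
  a @ \oo --> (0 : R) ->
  (fun n => Num.sqrt (n%:R) * a n) @ \oo --> +oo ->
  density rho ->
  0 < mutinf_var rho ->
  let Rn := fun n : nat => mutinf rho - a n in
  (fun n : nat => - ln (alpha_hat rho n (expR (- (n%:R * Rn n))))
                  / (n%:R * a n ^+ 2))
    @ \oo --> (2 * mutinf_var rho)^-1
  /\
  (fun n : nat => - ln (alpha_hat_iid rho n (expR (- (n%:R * Rn n))))
                  / (n%:R * a n ^+ 2))
    @ \oo --> (2 * mutinf_var rho)^-1.
Proof.
move=> a0 a1 a2 hr hV Rn.
have le n : alpha_hat_iid rho n (expR (- (n%:R * Rn n))) <= alpha_hat rho n (expR (- (n%:R * Rn n))).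
  by apply: alpha_iid_le_hat => //; apply: expR_ge0.
split; apply: exponent_cvg => // e e0.
- by apply: filterS (near_alpha_hat_iid_ge a0 a1 a2 hr hV e0) => n h; apply: le_trans h (le n).
- exact: near_alpha_hat_le.
- exact: near_alpha_hat_iid_ge.
- by apply: filterS (near_alpha_hat_le a0 a1 a2 hr hV e0) => n h; apply: le_trans (le n) h.
Qed.
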